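(* Let $G$ be a discrete Cayley graph with vertex set $V$, and let $\mathcal X_n=\{X_{n,x}\}_{x\in W_n}$, $n\ge1$, be a sequence of real-valued random fields such that $\sup_{n\ge1}\sup_{x\in W_n}\mathbb E(|X_{n,x}|^p)<\infty$ for all $p\ge1$. Assume that $\mathcal X_n$ satisfy clustering of mixed moments: there exist constants $C^X_K,c^X_K\in(0,\infty)$, $K\ge1$, and a fast decreasing function $\phi_X$ which is summable in $G$, such that for all $n\ge1$, all $p,q\ge1$, all $z_1,\dots,z_{p+q}\in W_n$ and all integers $k_1,\dots,k_{p+q}\ge1$, with $K=\sum_{i=1}^{p+q}k_i$ and $s=d(\{z_1,\dots,z_p\},\{z_{p+1},\dots,z_{p+q}\})$, $$\Bigl|\mathbb E\Bigl(\prod_{i=1}^{p+q}X_{n,z_i}^{k_i}\Bigr)-\mathbb E\Bigl(\prod_{i=1}^{p}X_{n,z_i}^{k_i}\Bigr)\mathbb E\Bigl(\prod_{i=p+1}^{p+q}X_{n,z_i}^{k_i}\Bigr)\Bigr|\le C^X_K\,\phi_X(c^X_Ks).$$ Set $H_n=\sum_{x\in W_n}X_{n,x}$. If for some $\nu>0$ it holds that $\operatorname{Var}(H_n)=\Omega(w_n^\nu)$, then as $n\to\infty$, $$\frac{H_n-\mathbb E(H_n)}{\sqrt{\operatorname{Var}(H_n)}}\stackrel{d}{\Rightarrow}N(0,1).$$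
   Context: $(V,+)$ is a countably infinite group (not necessarily commutative) with identity $O$, generated by a finite symmetric set $S$ ($h\in S\iff -h\in S$) with $O\notin S$. The discrete Cayley graph $G=(V,E)$ has $(g_1,g_2)\in E$ iff $-g_1+g_2\in S$. $d$ is the graph distance, $|x|=d(O,x)$; $d(A,B)=\min_{x\in A,y\in B}d(x,y)$. $W_n=\{x:|x|\le n\}$ and $w_n=|W_n|$. A function $\phi:[0,\infty)\to[0,\infty)$ is fast decreasing if $\phi\le1$, $\phi$ is decreasing and $\lim_{s\to\infty}s^m\phi(s)=0$ for all $m\ge1$; it is summable in $G$ if $\sum_{x\in V}\phi^{1/p}(c|x|)<\infty$ for all $c>0$, $p\ge1$. $a_n=\Omega(b_n)$ means that there is $c>0$ with $a_n\ge c\,b_n$ for all large $n$. *)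

(* Defs.v *)
From HB Require Import structures.
From mathcomp Require Import all_boot all_order all_algebra.
From mathcomp Require Import monoid finmap.
From mathcomp Require Import all_classical all_reals all_analysis.
From mathcomp Require Import measurable_realfun.

Set Implicit Arguments.
Unset Strict Implicit.
Unset Printing Implicit Defensive.

Import Order.TTheory GRing.Theory Num.Theory.
Import numFieldNormedType.Exports.

Local Open Scope classical_set_scope.
Local Open Scope ring_scope.

(* [0] when [D] is empty. *)
Definition nat_min (D : set nat) : nat :=
  match pselect (exists n, n \in D) with
  | left exD => ex_minn exD
  | right _ => 0%N
  end.

(* The group law is written multiplicatively: [1], [x * y] and [x^-1] stand for
   the O, x + y and -x of a group that need not be commutative. *)
Section cayley.
Variables (V : groupType) (S : set V).

Definition subgroup_set (H : set V) : Prop :=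
  [/\ H 1%g, (forall x y, H x -> H y -> H (x * y)%g)
    & (forall x, H x -> H x^-1%g)].

Definition generates : Prop :=
  forall H : set V, subgroup_set H -> S `<=` H -> H = [set: V].

Definition cayley_data : Prop :=
  [/\ countable [set: V], infinite_set [set: V],
      [/\ finite_set S, (forall h, S h <-> S h^-1%g) & ~ S 1%g]
    & generates].

Definition cayley_edge : rel V := fun g1 g2 => (g1^-1 * g2)%g \in S.

Definition cayley_dist (x y : V) : nat :=
  nat_min [set size p | p in [set p | path cayley_edge x p /\ last x p = y]].

Definition cayley_len (x : V) : nat := cayley_dist 1%g x.

Definition cayley_setdist (A B : set V) : nat :=
  nat_min [set cayley_dist x y | x in A & y in B].

Definition cayley_ball (n : nat) : set V :=
  [set x | (cayley_len x <= n)%N].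

Definition cayley_growth (n : nat) : nat := #|` fset_set (cayley_ball n)|%fset.

End cayley.

(* Only the values of [phi] on [0, +oo[ are constrained. *)
Definition fast_decreasing (R : realType) (phi : R -> R) : Prop :=
  [/\ (forall s : R, 0 <= s -> 0 <= phi s <= 1),
      (forall s t : R, 0 <= s -> s <= t -> phi t <= phi s)
    & (forall m : nat, (1 <= m)%N -> s ^+ m * phi s @[s --> +oo] --> 0)].

Definition summable_in (R : realType) (V : groupType) (S : set V)
    (phi : R -> R) : Prop :=
  forall c p : R, 0 < c -> 1 <= p ->
    (\esum_(x in [set: V]) (phi (c * (cayley_len S x)%:R) `^ p^-1)%:E
      < +oo)%E.

Section random_fields.
Variables (R : realType) (V : groupType) (S : set V).
Variables (d : nat -> measure_display) (T : forall n, measurableType (d n)).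
Variable P : forall n, probability (T n) R.
(* Only the variables [X n x] with [1 <= n] and [x] in the ball of radius [n]
   play a role below. *)
Variable X : forall n, V -> {RV P n >-> R}.

Definition bounded_moments : Prop :=
  forall p : R, 1 <= p ->
    (ereal_sup [set ereal_sup
        [set 'E_(P n)[(fun w => `|X n x w| `^ p)%R] | x in cayley_ball S n]
      | n in [set n | (1 <= n)%N]] < +oo)%E.

Definition clustering_mixed_moments (C c : nat -> R) (phi : R -> R) : Prop :=
  forall (n p q : nat) (z : 'I_(p + q) -> V) (k : 'I_(p + q) -> nat),
    (1 <= n)%N -> (1 <= p)%N -> (1 <= q)%N ->
    (forall i, cayley_ball S n (z i)) -> (forall i, (1 <= k i)%N) ->
    let K := (\sum_(i < p + q) k i)%N in
    let s := cayley_setdist S [set z (lshift q i) | i in [set: 'I_p]]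
                              [set z (rshift p j) | j in [set: 'I_q]] in
    (`| 'E_(P n)[(fun w => \prod_(i < p + q) X n (z i) w ^+ k i)%R]
        - 'E_(P n)[(fun w =>
              \prod_(i < p) X n (z (lshift q i)) w ^+ k (lshift q i))%R]
          * 'E_(P n)[(fun w =>
              \prod_(j < q) X n (z (rshift p j)) w ^+ k (rshift p j))%R] |
      <= (C K * phi (c K * s%:R))%:E)%E.

Definition field_sum (n : nat) : {mfun T n >-> R} :=
  \sum_(x \in cayley_ball S n) (X n x : {mfun T n >-> R}).

End random_fields.

(* [(Y - E Y) / sqrt (Var Y)]; this is [0] when the variance is [0]. *)
Definition standardize (R : realType) (d : measure_display)
    (T : measurableType d) (P : probability T R) (Y : {mfun T >-> R}) :
    {mfun T >-> R} :=
  (Num.sqrt (fine 'V_P[Y]))^-1 *: (Y - cst (fine 'E_P[Y])).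

(* The [Y n] may live on different probability spaces; [nu] is the limit law. *)
Definition cvg_in_law (R : realType) (d : nat -> measure_display)
    (T : forall n, measurableType (d n)) (P : forall n, probability (T n) R)
    (Y : forall n, {RV P n >-> R}) (nu : probability (measurableTypeR R) R) :
    Prop :=
  forall f : R -> R, continuous f -> (exists M : R, forall x, `|f x| <= M) ->
    'E_(P n)[f \o Y n]%E @[n --> \oo] --> (\int[nu]_x (f x)%:E)%E.

(* Landau's Omega without the absolute values of the library's
   [f =Omega_F h]. *)
Definition seq_Omega (R : realType) (a b : nat -> R) : Prop :=
  exists c : R, 0 < c /\ \forall n \near \oo, c * b n <= a n.

(* Main.v *)
(* The joint cumulant of X_{n,x_0}, ..., X_{n,x_k} vanishes when the moments
   factorize along a splitting of the points, so clustering makes it small when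
   the points fall into two distant groups.  Points at distance at most r from
   x_0, with r attained, always split into two groups at distance at least
   r / (k + 1); summing over the points with the summability of phi, each
   cumulant of H_n is O(w_n).  As Var(H_n) >= c w_n^nu, the
   cumulants of large order of the standardized H_n tend to 0.

   By an argument of Janson all those of order k >= 3 then tend to 0.
   Otherwise rescale further, so that the cumulants of order 2, ..., K - 1 are
   bounded by 1 and one of them has modulus 1.  Limits along an ultrafilter are
   the cumulants of a positive moment sequence whose moment generating function
   is M = exp(L) with L a polynomial.  The inequality |M(z)| <= M(Re z) on rays
   from the origin forces deg L <= 2 (Marcinkiewicz), so the limit of order 2
   is the only nonzero one, and the rescaling was trivial.

   Hence the moments converge to those of N(0,1).  To pass to a bounded
   continuous f, approximate it on [-A, A] by a polynomial in sin(t x), at a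
   cost O(x^2 / A^2) elsewhere; the expectation of a trigonometric polynomial is
   given by moments up to a Taylor remainder, which the growth of the Gaussian
   moments makes small. *)

Require Import Defs.
From mathcomp Require Import all_boot all_order all_algebra.
From mathcomp Require Import monoid finmap.
From mathcomp Require Import all_classical all_reals all_analysis.
From mathcomp Require Import measurable_realfun.
From mathcomp Require Import ring lra zify.

Set Implicit Arguments.
Unset Strict Implicit.
Unset Printing Implicit Defensive.

Import Order.TTheory GRing.Theory Num.Theory.
Import numFieldNormedType.Exports.

Local Open Scope classical_set_scope.
Local Open Scope ring_scope.

(** * Marcinkiewicz' theorem *)

(** The O(w_n) bound leaves the standardized cumulants of order k < 2 / nu without any a priori
    bound; this gap is what Janson's argument closes.

    No measure is at hand for the limiting sequence of that argument, and everything is done over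
    the reals. A moment sequence is a sequence of reals subject to two conditions that survive
    termwise limits: the recursion [cumulant_rec], which is M' = L' M read on coefficients, and
    positivity of the Hankel forms. The ridge inequality comes from the Hankel forms alone, applied
    to the Taylor coefficients of g(x) = Im (exp (i al + rho e^(i th) x)), because g^2 = (exp (2 rho
    x cos th) - Re (exp (2 i al + 2 rho e^(i th) x))) / 2. Its logarithmic form needs |M|^2 = exp (2
    Re L), which becomes a differential equation in r along each ray.

    On the graph side, the roots phi^(1/p) in the summability condition let a decay in the largest
    of k distances be replaced by a product over the k points, so that the sum over the points
    factorizes. *)

Lemma cvg_sumr (R : realType) (T I : Type) (F : set_system T) (r : seq I)
    (P : pred I) (f : I -> T -> R) (a : I -> R) : Filter F ->
  (forall i, P i -> f i x @[x --> F] --> a i) ->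
  \sum_(i <- r | P i) f i x @[x --> F] --> \sum_(i <- r | P i) a i.
Proof. by move=> FF; apply: cvg_big; exact: add_continuous. Qed.

Lemma cvg_mulc (R : realType) (T : Type) (F : set_system T) (k : R) (f : T -> R)
    (a : R) : Filter F ->
  f x @[x --> F] --> a -> k * f x @[x --> F] --> k * a.
Proof. by move=> FF; apply: cvgM; exact: cvg_cst. Qed.

Section entire.
Variable R : realType.
Implicit Types (a : nat -> R) (x : R).

Definition entire a := forall B, 0 <= B -> exists D, forall k, `|a k| * B ^+ k <= D.

Lemma entire_cvg a x : entire a -> cvgn (pseries a x).
Proof.
move=> /(_ (2 * `|x| + 1)) []; first by rewrite addr_ge0// mulr_ge0.
move=> D hD; set B := 2 * `|x| + 1 in hD.
have B0 : 0 < B by rewrite ltr_wpDl// mulr_ge0.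
apply: normed_cvg; rewrite /normed_series_of.
have hx : `| `|x| / B| < 1.
  rewrite normrM normr_id normfV (ger0_norm (ltW B0)) ltr_pdivrMr// mul1r /B.
  by have := normr_ge0 x; lra.
apply: (series_le_cvg (v_ := geometric D (`|x| / B))) => [k|k|k|] //=.
- rewrite mulr_ge0//; last by rewrite exprn_ge0// divr_ge0// ltW.
  by apply: le_trans (hD 0%N); rewrite mulr_ge0.
- rewrite expr_div_n mulrA ler_pdivlMr ?exprn_gt0// normrM normrX mulrAC.
  by rewrite ler_wpM2r// exprn_ge0.
- exact: is_cvg_geometric_series.
Qed.

Lemma entire_diffs a : entire a -> entire (pseries_diffs a).
Proof.
move=> ea B B0; have [|D hD] := ea (2 * B + 1); first by lra.
exists D => k; apply: le_trans (hD k.+1).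
rewrite /pseries_diffs normrM mulrAC [leRHS]mulrC ler_wpM2r// exprS.
rewrite normr_nat; apply: (@le_trans _ _ ((2 * B) ^+ k)).
  rewrite exprMn ler_wpM2r ?exprn_ge0// -natrX ler_nat.
  exact: ltn_expl.
rewrite -[leLHS]mul1r ler_pM ?exprn_ge0//; [lra|lra|].
by rewrite lerXn2r ?nnegrE//; lra.
Qed.

Lemma entire_derive a x : entire a ->
  is_derive x (1 : R) (fun x => limn (pseries a x))
    (limn (pseries (pseries_diffs a) x)).
Proof.
move=> ea; apply: (@pseries_snd_diffs _ _ (`|x| + 1)).
- exact: entire_cvg.
- exact/entire_cvg/entire_diffs.
- exact/entire_cvg/entire_diffs/entire_diffs.
- by rewrite [ltRHS]ger0_norm ?ltrDl// addr_ge0.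
Qed.

Lemma entire_le a b : (forall k, `|b k| <= `|a k|) -> entire a -> entire b.
Proof.
move=> ba ea B B0; have [D hD] := ea B B0; exists D => k.
by apply: le_trans (hD k); rewrite ler_wpM2r ?exprn_ge0.
Qed.

(** The recursion says M' = c M with a polynomial c. Weighted by B^k, the term of index k+1 is at
    most S / (k+1) times a bound for the earlier ones, where S = sum_j |c_j| B^(j+1); so the
    weighted terms stop growing once k exceeds S. *)
Lemma rec_entire a (c : nat -> R) N : (forall j, (N <= j)%N -> c j = 0) ->
  (forall k, k.+1%:R * a k.+1 = \sum_(j < k.+1) c j * a (k - j)%N) -> entire a.
Proof.
move=> cN ha.
suff H B : 0 < B -> exists D, forall k, `|a k| * B ^+ k <= D.
  move=> B B0; have [|D hD] := H (B + 1); first by rewrite ltr_wpDl.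
  exists D => k; apply: le_trans (hD k).
  by rewrite ler_wpM2l// lerXn2r ?nnegrE ?addr_ge0// lerDl.
move=> B0; pose S := \sum_(j < N) `|c j| * B ^+ j.+1.
have S0 : 0 <= S by apply: sumr_ge0 => j _; rewrite mulr_ge0 ?exprn_ge0// ltW.
pose K := Num.bound S.
have b0 k : 0 <= `|a k| * B ^+ k by rewrite mulr_ge0 ?exprn_ge0// ltW.
exists (\sum_(i < K.+1) `|a i| * B ^+ i).
set D := \sum_(i < K.+1) _.
have D0 : 0 <= D by apply: sumr_ge0.
elim/ltn_ind => -[|k] IH; last have [kK|Kk] := ltnP k K.
- by rewrite /D big_ord_recl lerDl sumr_ge0.
- rewrite /D (bigD1 (Ordinal (kK : (k.+1 < K.+1)%N)))//= lerDl.
  by rewrite sumr_ge0.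
rewrite -(ler_pM2l (ltr0Sn R k)) mulrA.
rewrite -{1}[k.+1%:R]normr_nat -normrM ha.
apply: (@le_trans _ _ (\sum_(j < k.+1) `|c j| * B ^+ j.+1 * D)).
  rewrite (le_trans (ler_wpM2r _ (ler_norm_sum _ _ _))) ?exprn_ge0 ?(ltW B0)//.
  rewrite mulr_suml; apply: ler_sum => j _; rewrite normrM.
  have -> : B ^+ k.+1 = B ^+ j.+1 * B ^+ (k - j) by rewrite -exprD addSn subnKC -1?ltnS.
  rewrite mulrACA ler_wpM2l ?mulr_ge0 ?exprn_ge0 ?(ltW B0)// IH//.
  by rewrite ltnS leq_subr.
rewrite -mulr_suml ler_wpM2r//; apply: (@le_trans _ _ S).
  rewrite /S -!(big_mkord xpredT (fun j => `|c j| * B ^+ j.+1)).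
  have [kN|Nk] := leqP k.+1 N.
    rewrite (big_cat_nat (n := k.+1) (p := N))//= lerDl.
    by rewrite sumr_ge0// => j _; rewrite mulr_ge0 ?exprn_ge0// ltW.
  rewrite (big_cat_nat (n := N) (p := k.+1))//=; last exact: ltnW.
  rewrite [X in _ + X]big_nat_cond [X in _ + X]big1 ?addr0//.
  by move=> j /andP[/andP[Nj _] _]; rewrite cN// normr0 mul0r.
have : S < K%:R by exact: archi_boundP.
by move=> /ltW /le_trans; apply; rewrite ler_nat ltnW.
Qed.

Lemma sum_triangle (V : nmodType) (F : nat -> nat -> V) n :
  \sum_(0 <= k < n) \sum_(0 <= j < k.+1) F j (k - j)%N =
  \sum_(0 <= j < n) \sum_(0 <= i < n - j) F j i.
Proof.
elim: n => [|n IH]; first by rewrite !big_nil.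
rewrite big_nat_recr//= IH [in RHS]big_nat_recr//= subSn// subnn big_nat1.
rewrite [X in _ + X]big_nat_recr//= subnn addrA -big_split/=; congr (_ + _).
apply: eq_big_nat => j /andP[_ jn]; rewrite subSn ?(ltnW jn)//.
by rewrite [RHS]big_nat_recr.
Qed.

End entire.

Section rays.
Variables (R : realType) (a c : nat -> R) (N : nat).
Hypothesis cN : forall j, (N <= j)%N -> c j = 0.
Hypothesis a0 : a 0%N = 1.
Hypothesis ha : forall k, k.+1%:R * a k.+1 = \sum_(j < k.+1) c j * a (k - j)%N.

(* With M(z) = sum_k a_k z^k = exp (L(z)) and L(z) = sum_j c_j z^(j+1) / (j+1),
   [ray th be r] is Re (e^(i be) M(r e^(i th))) and [log_ray th] is the
   polynomial r |-> Re (L(r e^(i th))). *)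
Definition ray_coef th be k := a k * cos (k%:R * th + be).
Definition ray th be r := limn (pseries (ray_coef th be) r).

Lemma entire_ray_coef th be : entire (ray_coef th be).
Proof.
apply: entire_le (rec_entire cN ha) => k.
by rewrite normrM ler_piMr// cos_max.
Qed.

Lemma ray_cvg th be r : pseries (ray_coef th be) r @ \oo --> ray th be r.
Proof. exact/entire_cvg/entire_ray_coef. Qed.

Lemma rayD th be ga r :
  ray th (be + ga) r = cos ga * ray th be r + sin ga * ray th (be + pi / 2) r.
Proof.
apply/cvg_lim => //.
rewrite (_ : pseries _ r = (fun n => cos ga * pseries (ray_coef th be) r n +
    sin ga * pseries (ray_coef th (be + pi / 2)) r n)).
  by apply: cvgD; apply: cvg_mulc; exact: ray_cvg.
apply/funext => n; rewrite /pseries /series/= !mulr_sumr -big_split/=.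
apply: eq_bigr => i _; rewrite /ray_coef addrA cosD addrA cosDpihalf; ring.
Qed.

(** This is M' = L' M along the ray: the term c_j z^j of L', together with the factor e^(i th) from
    differentiating r e^(i th), turns the phase by (j+1) th. *)
Lemma ray_diffs th be r :
  limn (pseries (pseries_diffs (ray_coef th be)) r) =
  \sum_(j < N) c j * r ^+ j * ray th (be + j.+1%:R * th) r.
Proof.
apply/cvg_lim => //.
rewrite (_ : pseries _ r = (fun n => \sum_(j < N) c j * r ^+ j *
    pseries (ray_coef th (be + j.+1%:R * th)) r (n - j)%N)).
  apply: cvg_sumr => j _; apply: cvg_mulc.
  apply: (cvg_comp (fun n => (n - j)%N)); last exact: ray_cvg.
  by apply: cvg_subnr.
apply/funext => n; rewrite /pseries /series/=.
pose F j i := c j * r ^+ j * (ray_coef th (be + j.+1%:R * th) i * r ^+ i).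
transitivity (\sum_(0 <= k < n) \sum_(0 <= j < k.+1) F j (k - j)%N).
  apply: eq_bigr => k _; rewrite /pseries_diffs /ray_coef mulrA ha.
  rewrite !mulr_suml big_mkord; apply: eq_bigr => j _.
  have jk : (j <= k)%N by rewrite -ltnS.
  have -> : r ^+ k = r ^+ j * r ^+ (k - j) by rewrite -exprD subnKC.
  rewrite /F /ray_coef.
  rewrite (_ : k.+1%:R * th + be = (k - j)%:R * th + (be + j.+1%:R * th)); first by ring.
  by rewrite -natr1 natrB// -natr1; ring.
rewrite sum_triangle.
transitivity (\sum_(0 <= j < N) \sum_(0 <= i < n - j) F j i); last first.
  by rewrite big_mkord; apply: eq_bigr => j _; rewrite mulr_sumr.
have [nN|Nn] := leqP n N.
  rewrite [RHS](big_cat_nat (n := n))//= [X in _ = _ + X]big_nat_cond.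
  rewrite [X in _ = _ + X]big1 ?addr0// => j /andP[/andP[nj _] _].
  by rewrite (eqP nj) big_nil.
rewrite (big_cat_nat (n := N))//= ?(ltnW Nn)// [X in _ + X]big_nat_cond.
rewrite [X in _ + X]big1 ?addr0// => j /andP[/andP[nj _] _].
by rewrite big1// => i _; rewrite /F cN// !mul0r.
Qed.

Lemma ray_derive th be r : is_derive r (1 : R) (ray th be)
  (\sum_(j < N) c j * r ^+ j * ray th (be + j.+1%:R * th) r).
Proof. rewrite -ray_diffs; exact/entire_derive/entire_ray_coef. Qed.

Definition log_ray th := \poly_(j < N.+1)
  (if j is j'.+1 then c j' / j%:R * cos (j%:R * th) else 0).

Lemma horner_log_ray th r :
  (log_ray th).[r] = \sum_(j < N) c j / j.+1%:R * cos (j.+1%:R * th) * r ^+ j.+1.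
Proof. by rewrite horner_poly big_ord_recl/= mul0r add0r. Qed.

Lemma deriv_log_ray th r :
  (log_ray th)^`().[r] = \sum_(j < N) c j * r ^+ j * cos (j.+1%:R * th).
Proof.
rewrite /log_ray poly_def raddf_sum/= horner_sum big_ord_recl/=.
rewrite scale0r deriv0 horner0 add0r; apply: eq_bigr => j _.
rewrite linearZ/= derivXn/= hornerZ hornerMn hornerXn -mulr_natr.
by field; rewrite pnatr_eq0.
Qed.

(** The identity |M|^2 = exp (2 Re L): the product G of |M|^2 and exp (-2 Re L) has derivative 0 in
    r and equals 1 at r = 0. *)
Lemma ray_modulus th r :
  ray th 0 r ^+ 2 + ray th (pi / 2) r ^+ 2 = expR (2 * (log_ray th).[r]).
Proof.
pose u := ray th 0; pose v := ray th (pi / 2).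
pose G := (u ^+ 2 + v ^+ 2) * (expR \o horner (- 2%:P * log_ray th)).
suff /(_ r 0) : forall x y, G x = G y.
  rewrite /G/= !fctE/= !hornerM !hornerN !hornerC mulNr => /(canRL (mulfK _)) ->.
    rewrite expRN invrK.
    have ->: (log_ray th).[0] = 0.
      rewrite horner_log_ray big1// => j _; rewrite expr0n/= mulr0//.
    rewrite mulr0 expR0 mulr1.
    have r0 be : ray th be 0 = cos be.
      apply/cvg_lim => //; apply: cvg_near_cst; near=> n.
      have n0 : (0 < n)%N by near: n; exists 1%N.
      rewrite /pseries /series/= big_ltn// expr0 mulr1 /ray_coef a0 mul1r mul0r.
      rewrite add0r big_nat_cond big1 ?addr0// => -[|i]//.
      by rewrite exprS mul0r mulr0.
    by rewrite /u /v !r0 cos0 cos_pihalf expr1n expr0n/= addr0 mul1r.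
  by rewrite expR_eq0.
move=> x y; apply: is_derive_0_is_cst => {x y} x.
(* A + i B is e^(i th) L'(x e^(i th)), and u - i v is M, since v is the real part of i M. *)
pose A := (log_ray th)^`().[x].
pose B := \sum_(j < N) c j * x ^+ j * sin (j.+1%:R * th).
have du : is_derive x (1 : R) u (A * u x + B * v x).
  apply: is_derive_eq (ray_derive th 0 x) _.
  rewrite /A /B deriv_log_ray !mulr_suml -big_split/=; apply: eq_bigr => j _.
  by rewrite rayD add0r -/u -/v; ring.
have dv : is_derive x (1 : R) v (A * v x - B * u x).
  apply: is_derive_eq (ray_derive th (pi / 2) x) _.
  rewrite /A /B deriv_log_ray !mulr_suml -sumrB; apply: eq_bigr => j _.
  rewrite rayD -/v (_ : ray th _ x = - u x); first by ring.
  rewrite rayD cos_pihalf sin_pihalf mul0r mul1r add0r.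
  rewrite (_ : pi / 2 + pi / 2 = pi) -?splitr// -[pi]add0r rayD.
  by rewrite cospi sinpi mul0r addr0 mulN1r.
have dE : is_derive x (1 : R) (expR \o horner (- 2%:P * log_ray th))
    (expR (- 2%:P * log_ray th).[x] * (- 2 * A)).
  have -> : - 2 * A = (- 2%:P * log_ray th)^`().[x].
    by rewrite derivM derivN derivC oppr0 mul0r add0r hornerM hornerN hornerC.
  exact: is_derive1_comp.
apply: is_derive_eq (is_deriveM (is_deriveD (is_deriveX 2 du) (is_deriveX 2 dv)) dE) _.
by rewrite /GRing.scale/= !fctE/= !expr1; ring.
Unshelve. all: by end_near. Qed.

End rays.

Lemma sum_binS (R : pzSemiRingType) k (g : nat -> R) :
  \sum_(i < k.+2) 'C(k.+1, i)%:R * g i =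
  \sum_(i < k.+1) 'C(k, i)%:R * g i + \sum_(i < k.+1) 'C(k, i)%:R * g i.+1.
Proof.
rewrite big_ord_recl/= bin0; under eq_bigr do rewrite /bump/= add1n binS natrD mulrDl.
rewrite big_split/= addrA; congr (_ + _).
rewrite [in LHS]big_ord_recr/= bin_small// mul0r addr0.
by rewrite [RHS]big_ord_recl/= bin0.
Qed.

(** Real part of e^(i be) (e^(i th) + e^(- i th))^k, expanded by the binomial formula. *)
Lemma sum_bin_cos (R : realType) (th be : R) k :
  \sum_(i < k.+1) 'C(k, i)%:R * cos (i%:R * th - (k%:R - i%:R) * th + be) =
  (2 * cos th) ^+ k * cos be.
Proof.
elim: k be => [|k IH] be.
  by rewrite big_ord_recl big_ord0/= bin0 !mul0r addr0 subr0 mul0r subr0 add0r.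
rewrite (sum_binS _ (fun i => cos (i%:R * th - (k.+1%:R - i%:R) * th + be))).
have E1 i : i%:R * th - (k.+1%:R - i%:R) * th + be =
    i%:R * th - (k%:R - i%:R) * th + (be - th) by rewrite -natr1; ring.
have E2 i : i.+1%:R * th - (k.+1%:R - i.+1%:R) * th + be =
    i%:R * th - (k%:R - i%:R) * th + (be + th) by rewrite -!natr1; ring.
under eq_bigr do rewrite E1.
under [X in _ + X]eq_bigr do rewrite E2.
by rewrite !IH exprS cosB cosD; ring.
Qed.

Lemma sin_mul (R : realType) (x y : R) :
  sin x * sin y = 2^-1 * (cos (x - y) - cos (x + y)).
Proof. by rewrite cosB cosD; field. Qed.

(** For the moments of a random variable Y this is the expectation of (sum_i f_i Y^i)^2. It involves
    finitely many moments at a time, hence passes to limits. *)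
Definition hankel_psd (R : numDomainType) (m : nat -> R) :=
  forall (f : nat -> R) K,
    0 <= \sum_(0 <= i < K) \sum_(0 <= j < K) f i * f j * m (i + j)%N.

Section ridge.
Variables (R : realType) (a c : nat -> R) (N : nat).
Hypothesis cN : forall j, (N <= j)%N -> c j = 0.
Hypothesis a0 : a 0%N = 1.
Hypothesis ha : forall k, k.+1%:R * a k.+1 = \sum_(j < k.+1) c j * a (k - j)%N.
Hypothesis psd : hankel_psd (fun k => a k * k`!%:R).

(* Taylor coefficients of x |-> Im (exp (i al + rho e^(i th) x)). *)
Let fc rho th al i : R := rho ^+ i * sin (i%:R * th + al) / i`!%:R.

(** The degree k part of g^2 = (exp (2 rho x cos th) - Re (exp (2 i al + 2 rho e^(i th) x))) / 2,
    where g has the Taylor coefficients [fc] and x^k is replaced by the moment a_k k!. *)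
Let antidiagonal_sum rho th al k :
  \sum_(0 <= j < k.+1) fc rho th al j * fc rho th al (k - j)%N *
     (a (j + (k - j))%N * (j + (k - j))`!%:R) =
  2^-1 * (ray_coef a 0 0 k * (2 * rho * cos th) ^+ k -
          ray_coef a th (2 * al) k * (2 * rho) ^+ k).
Proof.
have S2 : \sum_(j < k.+1) ('C(k, j)%:R : R) = 2 ^+ k.
  have := sum_bin_cos (0 : R) 0 k; rewrite cos0 !mulr1 => <-.
  by apply: eq_bigr => i _; rewrite !mulr0 subrr add0r cos0 mulr1.
rewrite /ray_coef mulr0 addr0 cos0 mulr1 exprMn.
have := sum_bin_cos th 0 k; rewrite cos0 mulr1 => S1.
rewrite mulrAC (exprMn _ 2 rho) -[in RHS]S2.
rewrite big_mkord.
transitivity (\sum_(j < k.+1) 2^-1 * (a k * rho ^+ k) * ('C(k, j)%:R *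
    (cos (j%:R * th - (k%:R - j%:R) * th + 0) - cos (k%:R * th + 2 * al)))).
  apply: eq_bigr => j _; have jk : (j <= k)%N by rewrite -ltnS.
  rewrite subnKC// /fc.
  have -> : rho ^+ k = rho ^+ j * rho ^+ (k - j) by rewrite -exprD subnKC.
  have := bin_fact jk => /(congr1 (fun n => n%:R : R)); rewrite !natrM => <-.
  have j0 : (j`!%:R : R) != 0 by rewrite pnatr_eq0 -lt0n fact_gt0.
  have kj0 : ((k - j)`!%:R : R) != 0 by rewrite pnatr_eq0 -lt0n fact_gt0.
  rewrite [in LHS]natrB//.
  have E : sin (j%:R * th + al) * sin ((k%:R - j%:R) * th + al) = 2^-1 *
      (cos (j%:R * th - (k%:R - j%:R) * th + 0) - cos (k%:R * th + 2 * al)).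
    by rewrite sin_mul; congr (_ * (cos _ - cos _)); ring.
  transitivity ((sin (j%:R * th + al) * sin ((k%:R - j%:R) * th + al)) *
    (rho ^+ j * rho ^+ (k - j) * a k * 'C(k, j)%:R)); first by field; rewrite j0 kj0.
  by rewrite E; ring.
rewrite -mulr_sumr; under eq_bigr do rewrite mulrBr.
rewrite sumrB S1 -mulr_suml S2 !exprMn; ring.
Qed.

(** Half the difference of the two sides is the limit of [Tri K], the part i + j < K of a Hankel
    form. The form itself is nonnegative on the full square i, j < K, and its terms beyond the
    triangle are negligible. *)
Lemma ray_le th be r : ray a th be r <= ray a 0 0 (r * cos th).
Proof.
have [rho r2] : exists rho, 2 * rho = r by exists (r / 2); rewrite mulrC divfK.
have [al b2] : exists al, 2 * al = be by exists (be / 2); rewrite mulrC divfK.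
pose t i j := fc rho th al i * fc rho th al j * (a (i + j)%N * (i + j)`!%:R).
pose Tri K := \sum_(0 <= k < K) \sum_(0 <= j < k.+1) t j (k - j)%N.
have TriE K : Tri K = 2^-1 * (pseries (ray_coef a 0 0) (r * cos th) K -
                              pseries (ray_coef a th be) r K).
  rewrite /Tri /pseries /series/= -sumrB mulr_sumr.
  by apply: eq_bigr => k _; rewrite antidiagonal_sum r2 b2.
have ea := rec_entire cN ha.
(* The factor 2 absorbs the binomial coefficients in [t i j], and 8 pays for the at most K^2 terms
   outside the triangle: K^2 / 8^K <= 1 / 2^K. *)
have [|D hD] := ea (8 * (2 * `|rho|)); first by rewrite !mulr_ge0.
have D0 : 0 <= D by apply: le_trans (hD 0%N); rewrite mulr_ge0.
have tD i j : `|t i j| <= D * (8^-1) ^+ (i + j).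
  rewrite /t /fc !normrM !normfV !normr_nat exprVn ler_pdivlMr ?exprn_gt0//.
  apply: le_trans (hD (i + j)%N); rewrite !exprMn.
  set Y := _ * 8 ^+ _; rewrite [leRHS]mulrCA [leRHS]mulrC {}/Y ler_wpM2r ?exprn_ge0//.
  have i0 : (i`!%:R : R) != 0 by rewrite pnatr_eq0 -lt0n fact_gt0.
  have j0 : (j`!%:R : R) != 0 by rewrite pnatr_eq0 -lt0n fact_gt0.
  have := bin_fact (leq_addr j i); rewrite addKn => /(congr1 (fun n => n%:R : R)).
  rewrite !natrM => <-; rewrite !normrX.
  set si := `|sin _|; set sj := `|sin _|.
  rewrite [leLHS](_ : _ = si * sj * ('C(i + j, i)%:R * (`|a (i + j)%N| * `|rho| ^+ (i + j)))); last first.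
    by rewrite exprD; field; rewrite i0 j0.
  have [si1 sj1] : si <= 1 /\ sj <= 1 by rewrite !sin_max.
  have [si0 sj0] : 0 <= si /\ 0 <= sj by rewrite !normr_ge0.
  rewrite -[leRHS]mul1r ler_pM ?mulr_ge0 ?exprn_ge0//.
    by rewrite mulr_ile1.
  rewrite [leLHS]mulrCA ler_wpM2l// ler_wpM2r ?exprn_ge0// -natrX ler_nat.
  have := Pascal 1 1 (i + j); rewrite addn1 => ->.
  rewrite (bigD1 (inord i))//= !exp1n !muln1 inordK ?leq_addr// ltnS leq_addr//.
have Tri_ge K : - (D * (2^-1) ^+ K) <= Tri K.
  have := psd (fc rho th al) K; rewrite -/(Tri K).
  rewrite /Tri sum_triangle => h.
  have -> : \sum_(0 <= j < K) \sum_(0 <= i < K - j) t j i =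
    \sum_(0 <= i < K) \sum_(0 <= j < K) t i j -
    \sum_(0 <= i < K) \sum_(K - i <= j < K) t i j.
    rewrite -sumrB; apply: eq_bigr => i _.
    by rewrite [X in _ = X - _](big_cat_nat (n := (K - i)%N)) ?leq_subr//= addrK.
  rewrite lerBrDr (le_trans _ h)// addrC subr_le0.
  apply: (@le_trans _ _ (\sum_(0 <= i < K) \sum_(0 <= j < K) D * (8^-1) ^+ K)).
    apply: ler_sum_nat => i /andP[_ iK].
    rewrite [leRHS](big_cat_nat (n := (K - i)%N)) ?leq_subr//=.
    have e8 : 0 <= D * (8^-1) ^+ K by rewrite mulr_ge0 ?exprn_ge0 ?invr_ge0.
    rewrite -[leLHS]add0r lerD ?sumr_ge0//.
    apply: ler_sum_nat => j /andP[Kj jK].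
    rewrite (le_trans (ler_norm _))// (le_trans (tD i j))// ler_wpM2l//.
    rewrite ler_wiXn2l ?invr_ge0 ?invf_le1 ?ler1n//.
    by rewrite -leq_subLR.
  rewrite !sumr_const_nat subn0 -mulrnA -[leLHS]mulr_natr natrM -mulrA ler_wpM2l//.
  rewrite (_ : 8 = 2 * (2 * 2)); last by ring.
  rewrite !invfM !exprMn -[leRHS]mulr1 -!mulrA ler_wpM2l ?exprn_ge0 ?invr_ge0//.
  have h2 : (2^-1) ^+ K * K%:R <= 1 :> R.
    rewrite exprVn mulrC ler_pdivrMr ?exprn_gt0// mul1r -natrX ler_nat.
    exact/ltnW/ltn_expl.
  rewrite (_ : _ * _ = ((2^-1) ^+ K * K%:R) * ((2^-1) ^+ K * K%:R) :> R); last by ring.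
  by rewrite mulr_ile1// mulr_ge0 ?exprn_ge0 ?invr_ge0.
have cT : Tri K @[K --> \oo] --> 2^-1 * (ray a 0 0 (r * cos th) - ray a th be r).
  rewrite (_ : (fun K => Tri K) = (fun K => 2^-1 * (pseries (ray_coef a 0 0) (r * cos th) K -
                              pseries (ray_coef a th be) r K))); last exact/funext.
  by apply: cvg_mulc; apply: cvgB; apply: (ray_cvg cN ha).
have c0 : - (D * (2^-1) ^+ K) @[K --> \oo] --> (0 : R).
  rewrite -oppr0; apply: cvgN; rewrite -[X in _ --> X](mulr0 D).
  apply: cvg_mulc; apply: cvg_expr.
  by rewrite ger0_norm ?invr_ge0// invf_lt1// ltr1n.
have : 0 <= 2^-1 * (ray a 0 0 (r * cos th) - ray a th be r).
  by apply: (ler_cvg_to c0 cT); apply: nearW => K; exact: Tri_ge.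
by rewrite pmulr_rge0 ?invr_gt0// subr_ge0.
Qed.

End ridge.

Lemma polar (R : realType) (u v : R) : exists be,
  u = Num.sqrt (u ^+ 2 + v ^+ 2) * cos be /\ v = Num.sqrt (u ^+ 2 + v ^+ 2) * sin be.
Proof.
set rho := Num.sqrt _.
have rho2 : rho ^+ 2 = u ^+ 2 + v ^+ 2 by rewrite sqr_sqrtr// addr_ge0 ?sqr_ge0.
have [r0|r0] := eqVneq rho 0.
  exists 0; rewrite r0 !mul0r; move: rho2; rewrite r0 expr0n/= => /esym/eqP.
  by rewrite paddr_eq0 ?sqr_ge0// !sqrf_eq0 => /andP[/eqP-> /eqP->].
have rgt0 : 0 < rho by rewrite lt_neqAle eq_sym r0 sqrtr_ge0.
have uv : (u / rho) ^+ 2 + (v / rho) ^+ 2 = 1.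
  by rewrite !expr_div_n -mulrDl -rho2 divff// sqrf_eq0.
have hx : -1 <= u / rho <= 1.
  by rewrite -ler_norml -(@expr_le1 _ 2)// real_normK ?num_real// -uv lerDl sqr_ge0.
have s2 : Num.sqrt (1 - (u / rho) ^+ 2) = `|v / rho|.
  by rewrite -uv addrAC subrr add0r sqrtr_sqr.
have [v0|v0] := leP 0 v.
  exists (acos (u / rho)); rewrite acosK// sin_acos// s2 ger0_norm ?divr_ge0 ?(ltW rgt0)//.
  by rewrite ![rho * _]mulrC !divfK.
exists (- acos (u / rho)); rewrite cosN sinN acosK// sin_acos// s2 ltr0_norm; last first.
  by rewrite pmulr_llt0// invr_gt0.
by rewrite opprK ![rho * _]mulrC !divfK.
Qed.

Lemma top_coef_ge0 (R : realFieldType) (e : nat -> R) m :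
  (forall r, 1 <= r -> 0 <= \sum_(j < m.+1) e j * r ^+ j) -> 0 <= e m.
Proof.
move=> he; rewrite leNgt; apply/negP => em.
case: m em he => [|m] em he.
  by have := he 1 (lexx 1); rewrite big_ord_recl big_ord0 expr0 mulr1 addr0 leNgt em.
pose S := \sum_(j < m.+1) `|e j|; pose r := 1 + S / - e m.+1.
have S0 : 0 <= S by rewrite sumr_ge0.
have r1 : 1 <= r by rewrite lerDl divr_ge0// oppr_ge0 ltW.
have := he r r1; rewrite big_ord_recr/= leNgt => /negP; apply.
apply: (@le_lt_trans _ _ (S * r ^+ m + e m.+1 * r ^+ m.+1)).
  rewrite lerD2r /S mulr_suml; apply: ler_sum => j _.
  rewrite (le_trans (ler_norm _))// normrM normrX ler_wpM2l//.
  rewrite ger0_norm ?(le_trans ler01)// ler_weXn2l//.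
  by rewrite -ltnS.
rewrite exprS mulrA -mulrDl pmulr_llt0 ?exprn_gt0 ?(lt_le_trans ltr01)//.
have -> : S + e m.+1 * r = e m.+1 by rewrite /r; field; rewrite lt_eqF.
by [].
Qed.

Section marcinkiewicz.
Variables (R : realType) (a c : nat -> R).
Hypothesis a0 : a 0%N = 1.
Hypothesis ha : forall k, k.+1%:R * a k.+1 = \sum_(j < k.+1) c j * a (k - j)%N.
Hypothesis psd : hankel_psd (fun k => a k * k`!%:R).

(* The ridge property |M(z)| <= M(Re z) of a moment generating function, in
   logarithmic form. *)
Lemma log_ray_le N th r : (forall j, (N <= j)%N -> c j = 0) ->
  (log_ray c N th).[r] <= (log_ray c N 0).[r * cos th].
Proof.
move=> cN; rewrite -(ler_pM2l (ltr0n R 2)) -ler_expR -!(ray_modulus cN a0 ha).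
(* For this phase [be] the real part of e^(i be) M is the modulus [rho] of M, so [ray_le] bounds the
   modulus itself. *)
have [be [ub vb]] := polar (ray a th 0 r) (ray a th (pi / 2) r).
set rho := Num.sqrt _ in ub vb.
have rho_le : rho <= ray a 0 0 (r * cos th).
  apply: le_trans (ray_le cN ha psd th be r).
  rewrite -[be]add0r (rayD cN ha) add0r {1}ub {1}vb !mulrA.
  rewrite (_ : _ + _ = rho * (cos be ^+ 2 + sin be ^+ 2)); last by ring.
  by rewrite cos2Dsin2 mulr1.
rewrite -[leLHS]sqr_sqrtr ?addr_ge0 ?sqr_ge0// -/rho.
apply: (@le_trans _ _ (ray a 0 0 (r * cos th) ^+ 2)); last by rewrite lerDl sqr_ge0.
by rewrite lerXn2r ?nnegrE ?sqrtr_ge0// (le_trans _ rho_le)// sqrtr_ge0.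
Qed.

(** The coefficient of r^m in the ridge inequality gives 0 <= c_(m-1) / m (cos(th)^m - cos(m th)).
    The bracket is negative at th = 2 pi / m and positive at th = pi / m. For m = 2 it would vanish
    at th = 2 pi / m, hence the bound 2 < m. *)
Lemma top_coef_eq0 m : (2 < m)%N -> (forall j, (m <= j)%N -> c j = 0) ->
  c m.-1 = 0.
Proof.
move=> m2 cm; have m0 : (0 < m)%N by apply: leq_trans m2.
have mR : (m%:R : R) != 0 by rewrite pnatr_eq0 -lt0n.
have H th : 0 <= c m.-1 / m%:R * (cos th ^+ m - cos (m%:R * th)).
  pose e j := if j is j'.+1 then c j' / j%:R * (cos th ^+ j - cos (j%:R * th)) else 0.
  have <- : e m = c m.-1 / m%:R * (cos th ^+ m - cos (m%:R * th)).
    by rewrite /e; case: (m) m0.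
  apply: top_coef_ge0 => r _; rewrite big_ord_recl/= mul0r add0r.
  have := log_ray_le th r cm; rewrite -subr_ge0 !horner_log_ray -sumrB.
  congr (_ <= _); apply: eq_bigr => j _.
  by rewrite mulr0 cos0 exprMn /bump/=; ring.
have pim : 0 < pi / m%:R :> R by rewrite divr_gt0 ?pi_gt0// ltr0n.
have m3 : (3%:R : R) <= m%:R by rewrite ler_nat.
apply/eqP; rewrite eq_le; apply/andP; split.
  have := H (2 * pi / m%:R).
  have -> : m%:R * (2 * pi / m%:R) = 2 * pi :> R by field.
  have -> : cos (2 * pi) = 1 :> R by rewrite mulr_natl -[_ *+ 2]add0r cosD2pi cos0.
  have s0 : 0 < sin (2 * pi / m%:R) :> R.
    apply: sin_gt0_pi; rewrite -mulrA pmulr_rgt0// pim/=.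
    rewrite mulrA ltr_pdivrMr ?ltr0n//.
    by rewrite mulrC ltr_pM2l ?pi_gt0// (lt_le_trans _ m3)// ltr_nat.
  have c1 : cos (2 * pi / m%:R) ^+ m < 1 :> R.
    rewrite (le_lt_trans (ler_norm _))// normrX exprn_ilt1 -?lt0n//.
    rewrite -(@expr_lt1 _ 2)// real_normK ?num_real//.
    by rewrite cos2sin2 ltrBlDr ltrDl exprn_gt0.
  by rewrite nmulr_lge0 ?subr_lt0// pmulr_lle0// invr_gt0 ltr0n.
have := H (pi / m%:R).
have -> : m%:R * (pi / m%:R) = pi :> R by field.
rewrite cospi opprK pmulr_lge0; first by rewrite pmulr_lge0// invr_gt0 ltr0n.
rewrite addr_gt0// exprn_gt0// cos_gt0_pihalf//.
rewrite (lt_trans _ pim) ?oppr_lt0 ?divr_gt0 ?pi_gt0//=.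
by rewrite ltr_pM2l ?pi_gt0// ltf_pV2 ?posrE ?ltr0n// (lt_le_trans _ m3)// ltr_nat.
Qed.

(* Marcinkiewicz' theorem: a polynomial cumulant generating function has
   degree at most 2. *)
Lemma marcinkiewicz n : (forall j, (n <= j)%N -> c j = 0) ->
  forall j, (2 <= j)%N -> c j = 0.
Proof.
move=> cn; have {cn} : forall j, (n.+2 <= j)%N -> c j = 0.
  by move=> j nj; apply: cn; apply: leq_trans nj; rewrite -addn2 leq_addr.
elim: n => [//|n IH] cn; apply: IH => j; rewrite leq_eqVlt => /predU1P[<-|].
  exact: (@top_coef_eq0 n.+3).
exact: cn.
Qed.

End marcinkiewicz.

(** * Janson's theorem *)

(** Along one ultrafilter all bounded sequences converge at once, which replaces a diagonal
    extraction of subsequences. *)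
Lemma ultra_cvg (R : realType) (T : Type) (U : set_system T) (x : T -> R) B :
  UltraFilter U -> (\forall n \near U, `|x n| <= B) ->
  exists l : R, x n @[n --> U] --> l.
Proof.
move=> UU xB.
have [|l [_ cl]] := @segment_compact R (- B) B (x @ U) _.
  by apply: filterS xB => n; rewrite /= in_itv/= ler_norml.
exists l => N Nl; have [//|UN] := in_ultra_setVsetC (x @^-1` N) UU.
by have [y []] := cl (~` N) N UN Nl.
Qed.

(** The relation M' = (log M)' M between exponential generating functions. It constrains [tau] from
    index 1 on, and with m_0 = 1 each of the two sequences determines the other. *)
Definition cumulant_rec (R : pzSemiRingType) (m tau : nat -> R) :=
  forall k, m k.+1 = \sum_(j < k.+1) 'C(k, j)%:R * tau j.+1 * m (k - j)%N.

(** With a_k = m_k / k! and c_j = tau_(j+1) / j! this is the recursion of [rec_entire]. *)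
Lemma cumulant_rec_fact (R : realType) (m tau : nat -> R) k :
  cumulant_rec m tau ->
  k.+1%:R * (m k.+1 / k.+1`!%:R) =
  \sum_(j < k.+1) tau j.+1 / j`!%:R * (m (k - j)%N / (k - j)`!%:R).
Proof.
have f0 i : (i`!%:R : R) != 0 by rewrite pnatr_eq0 -lt0n fact_gt0.
move=> ->; rewrite factS natrM invfM mulrCA mulVKf ?pnatr_eq0// mulr_suml.
apply: eq_bigr => j _; have jk : (j <= k)%N by rewrite -ltnS.
have /(congr1 (fun n => n%:R : R)) := bin_fact jk; rewrite !natrM => <-.
have : ('C(k, j)%:R : R) != 0 by rewrite pnatr_eq0 -lt0n bin_gt0.
by move=> h; field; rewrite h !f0.
Qed.

(** By the recursion each moment is a polynomial in the cumulants of at most its order, so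
    convergence of cumulants gives that of moments. *)
Lemma cumulant_rec_cvg (R : realType) (T : Type) (U : set_system T)
    (m tau : T -> nat -> R) (s : nat -> R) : ProperFilter U ->
  (\forall n \near U, m n 0%N = 1 /\ cumulant_rec (m n) (tau n)) ->
  (forall j, tau n j @[n --> U] --> s j) ->
  exists m' : nat -> R, [/\ m' 0%N = 1, cumulant_rec m' s &
    forall k, m n k @[n --> U] --> m' k].
Proof.
move=> UF mtau ctau.
have cm k : exists l : R, m n k @[n --> U] --> l.
  elim/ltn_ind: k => -[|k] IH.
    by exists 1; apply: cvg_near_cst; apply: filterS mtau => n [->].
  have /choice[l cl] : forall j, exists l : R, (j <= k)%N -> m n j @[n --> U] --> l.
    by move=> j; have [/IH[l]|kj] := ltnP j k.+1; [exists l|exists 0; rewrite leqNgt kj].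
  exists (\sum_(j < k.+1) 'C(k, j)%:R * s j.+1 * l (k - j)%N).
  apply: (@cvg_trans _ ((fun n => \sum_(j < k.+1) 'C(k, j)%:R * tau n j.+1 * m n (k - j)%N) @ U)).
    by apply: near_eq_cvg; apply: filterS mtau => n [_ ->].
  apply: cvg_sumr => j _; apply: cvgM; first exact: cvg_mulc.
  by apply: cl; rewrite leq_subr.
have /choice[m' cm'] := cm; exists m'; split=> [|k|//].
  apply: (cvg_unique _ (cm' 0%N)) => //.
  by apply: cvg_near_cst; apply: filterS mtau => n [->].
apply: (cvg_unique _ (cm' k.+1)) => //.
apply: (@cvg_trans _ ((fun n => \sum_(j < k.+1) 'C(k, j)%:R * tau n j.+1 * m n (k - j)%N) @ U)).
  by apply: near_eq_cvg; apply: filterS mtau => n [_ ->].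
by apply: cvg_sumr => j _; apply: cvgM; first exact: cvg_mulc.
Qed.

Lemma hankel_psd_cvg (R : realType) (T : Type) (U : set_system T)
    (m : T -> nat -> R) (m' : nat -> R) : ProperFilter U ->
  (\forall n \near U, hankel_psd (m n)) ->
  (forall k, m n k @[n --> U] --> m' k) -> hankel_psd m'.
Proof.
move=> UF mpsd cm f K.
have cS : \sum_(0 <= i < K) \sum_(0 <= j < K) f i * f j * m n (i + j)%N @[n --> U] -->
    \sum_(0 <= i < K) \sum_(0 <= j < K) f i * f j * m' (i + j)%N.
  by apply: cvg_sumr => i _; apply: cvg_sumr => j _; exact: cvg_mulc.
by apply: (cvgr_to_ge cS); apply: filterS mpsd => n; apply.
Qed.

Section janson.
Variables (R : realType) (m tau : nat -> nat -> R) (K : nat).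
Hypothesis m0 : forall n, m n 0%N = 1.
Hypothesis mtau : forall n, cumulant_rec (m n) (tau n).
Hypothesis mpsd : forall n, hankel_psd (m n).
Hypothesis tau1 : forall n, tau n 1%N = 0.
Hypothesis tau2 : forall n, tau n 2%N = 1.
Hypothesis tauK : forall k, (K <= k)%N -> tau n k @[n --> \oo] --> 0.

(* After division by this factor all cumulants of order 2, ..., K - 1 lie in
   [-1, 1], and one of them is +1 or -1. *)
Let scale n := \big[Num.max/1]_(2 <= j < K) `|tau n j| `^ (j%:R^-1).

Let scale_ge1 n : 1 <= scale n.
Proof. exact: bigmax_ge_id. Qed.

Let scale_gt0 n : 0 < scale n.
Proof. exact: lt_le_trans (scale_ge1 n). Qed.

Let powR_natVK (x : R) j : (0 < j)%N -> 0 <= x -> (x `^ (j%:R^-1)) ^+ j = x.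
Proof.
by move=> j0 x0; rewrite -powR_mulrn ?powR_ge0// -powRrM mulVf ?pnatr_eq0 -?lt0n// powRr1.
Qed.

Let tau_le_scale n j : (2 <= j < K)%N -> `|tau n j| <= scale n ^+ j.
Proof.
move=> /andP[j2 jK]; have j0 : (0 < j)%N by apply: leq_trans j2.
rewrite -[leLHS](powR_natVK j0)// lerXn2r ?nnegrE ?powR_ge0 ?(ltW (scale_gt0 n))//.
by apply: (@le_bigmax_seq _ _ _ _ _ j xpredT) => //; rewrite mem_index_iota j2.
Qed.

(** A maximum attained at order 2 also gives [scale n = 1], because that cumulant is 1; the second
    alternative can therefore start at order 3. *)
Let scale_attained n : scale n = 1 \/
  exists2 j, (3 <= j < K)%N & `|tau n j| = scale n ^+ j.
Proof.
have : scale n = 1 \/ exists2 j, (2 <= j < K)%N & `|tau n j| = scale n ^+ j.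
  rewrite /scale big_nat; elim/big_ind: _ => [|x y hx hy|j jK]; first by left.
    by rewrite /Num.max; case: ifP.
  by right; exists j => //; rewrite powR_natVK//; case/andP: jK => /ltnW.
case=> [|[[|[|[|j]]]// jK tj]]; [by left| |by right; exists j.+3].
left; move: tj; rewrite tau2 normr1 => /esym/eqP.
by rewrite -[eqbRHS](expr1n _ 2) eqrXn2 ?ler01 ?(ltW (scale_gt0 n))// => /eqP.
Qed.

Let tau_ultra_cvg0 (U : set_system nat) k : UltraFilter U -> \oo `<=` U ->
  (3 <= k)%N -> tau n k @[n --> U] --> 0.
Proof.
move=> UU ooU k3.
have tauKU j : (K <= j)%N -> tau n j @[n --> U] --> 0.
  by move=> Kj; apply: cvg_trans (tauK Kj); exact: cvg_app.
have [/tauKU//|kK] := leqP K k.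
pose sg n j := tau n j / scale n ^+ j.
have sg_le n j : `|sg n j| <= `|tau n j|.
  rewrite normrM normfV ler_piMr// normrX invf_le1 ?exprn_gt0 ?normr_gt0 ?gt_eqF//.
  by rewrite exprn_ege1// ger0_norm// ltW.
have /choice[s cs] : forall j, exists l : R, sg n j.+1 @[n --> U] --> l.
  move=> j; have [Kj|jK] := leqP K j.+1.
    exists 0; apply/cvgr0Pnorm_lt => e e0.
    move/cvgr0Pnorm_lt: (tauKU _ Kj) => /(_ _ e0); apply: filterS => n.
    exact: le_lt_trans.
  apply: (@ultra_cvg _ _ _ _ 1) => //; apply: nearW => n.
  case: j jK => [|j] jK; first by rewrite /sg tau1 mul0r normr0.
  rewrite /sg normrM normfV ler_pdivrMr ?normr_gt0 ?expf_neq0 ?gt_eqF// mul1r.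
  by rewrite [leRHS]ger0_norm ?exprn_ge0 ?(ltW (scale_gt0 n))// tau_le_scale.
pose m1 n k := m n k / scale n ^+ k.
pose s' j := if j is j'.+1 then s j' else 0.
pose sg' n j := if j is j'.+1 then sg n j else 0.
have [|j|m' [m'0 m's cm']] := @cumulant_rec_cvg R nat U m1 sg' s' _.
- apply: nearW => n; split; first by rewrite /m1 expr0 m0 divr1.
  move=> i; rewrite /m1 mtau mulr_suml; apply: eq_bigr => j _.
  have ji : (j <= i)%N by rewrite -ltnS.
  have -> : scale n ^+ i.+1 = scale n ^+ j.+1 * scale n ^+ (i - j).
    by rewrite -exprD addSn subnKC.
  rewrite /= /sg.
  by field; rewrite !expf_neq0// gt_eqF.
- by case: j => [|j]; [exact: cvg_cst|exact: cs].
have m'psd : hankel_psd m'.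
  apply: hankel_psd_cvg cm'; apply: nearW => n f L.
  have := mpsd n (fun i => f i / scale n ^+ i) L; congr (_ <= _).
  apply: eq_bigr => i _; apply: eq_bigr => j _; rewrite /m1 exprD.
  by field; rewrite !expf_neq0// gt_eqF.
have s0 j : (3 <= j)%N -> s' j = 0.
  case: j => [//|j]; rewrite ltnS => j2.
  have := @marcinkiewicz R (fun k => m' k / k`!%:R) (fun j => s j / j`!%:R) _ _ _ K.
  have fK i (x : R) : x / i`!%:R * i`!%:R = x by rewrite divfK// pnatr_eq0 -lt0n fact_gt0.
  move=> /(_ _ _ _ _ j j2) h; apply/eqP.
  rewrite -[s' _](fK j) /= h ?mul0r//.
  + by rewrite m'0 divr1.
  + by move=> i; rewrite (cumulant_rec_fact _ m's).
  + by rewrite (_ : (fun k => _) = m')//; apply/funext => i; exact: fK.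
  + move=> i Ki; rewrite (_ : s i = 0) ?mul0r//.
    apply: (cvg_unique _ (cs i)) => //; apply/cvgr0Pnorm_lt => e e0.
    have Ki1 : (K <= i.+1)%N by apply: leq_trans Ki _.
    move/cvgr0Pnorm_lt: (tauKU _ Ki1) => /(_ _ e0); apply: filterS => n.
    exact: le_lt_trans.
have cs0 j : (3 <= j)%N -> sg n j @[n --> U] --> 0.
  by move=> j3; rewrite -(s0 j j3); case: j j3 => // j _; exact: cs.
have near_lt : \forall n \near U, forall j, (3 <= j < K)%N -> `|sg n j| < 1.
  have : \forall n \near U, forall j : 'I_K, (3 <= j)%N -> `|sg n j| < 1.
    apply: filter_forall => j; have [j3|j3] := ltnP 2 j; last first.
      exact: nearW.
    by move/cvgr0Pnorm_lt: (cs0 _ j3) => /(_ _ ltr01); apply: filterS.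
  apply: filterS => n h j /andP[j3 jK]; exact: (h (Ordinal jK)).
apply: cvg_trans (cs0 k k3); apply: near_eq_cvg; apply: filterS near_lt => n h.
(* If [scale n] were not 1, some rescaled cumulant of order 3, ..., K - 1 would have modulus 1,
   against [h]. So [sg n k] is [tau n k] for U-almost all n. *)
have [s1|[j jK tj]] := scale_attained n; first by rewrite /sg s1 expr1n divr1.
have := h j jK; rewrite /sg normrM tj normfV normrX ger0_norm ?(ltW (scale_gt0 n))//.
by rewrite divff ?ltxx// expf_neq0// gt_eqF.
Qed.

(** If the convergence fails, the indices n with |tau n k| >= e generate with the filter [\oo] a
    proper filter. An ultrafilter finer than it contradicts [tau_ultra_cvg0]. *)
Lemma janson k : (3 <= k)%N -> tau n k @[n --> \oo] --> 0.
Proof.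
move=> k3; apply/cvgr0Pnorm_lt => e e0; apply: contrapT => nF.
pose D := [set n | ~ `|tau n k| < e].
have DF : ProperFilter (within D \oo).
  apply: Build_ProperFilter_ex => A; rewrite /within/= => DA; apply: contrapT => nA.
  apply: nF; apply: filterS DA => n DA; apply: contrapT => nD; apply: nA.
  by exists n; exact: DA.
have [U [UU sU]] := ultraFilterLemma DF.
have ooU : \oo `<=` U by move=> A oA; apply: sU; apply: filterS oA.
have := tau_ultra_cvg0 UU ooU k3 => /cvgr0Pnorm_lt/(_ _ e0) h.
have hD : U D by apply: sU; exact: withinT.
by have [n [? ?]] := filter_ex (filterI h hD).
Qed.

End janson.

(** * The method of moments *)

(** Both functions x^(n+1) / (n+1)! - s h(x), s = 1 or -1, vanish at 0 and have a nonnegative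
    derivative on x >= 0. *)
Lemma le_norm_derive_pos (R : realType) (h dh : R -> R) n :
  (forall x, is_derive x (1 : R) h (dh x)) -> h 0 = 0 ->
  (forall x, 0 <= x -> `|dh x| <= x ^+ n / n`!%:R) ->
  forall x, 0 <= x -> `|h x| <= x ^+ n.+1 / n.+1`!%:R.
Proof.
move=> hdh h0 bdh x x0.
have key s : `|s| = 1 -> s * h x <= x ^+ n.+1 / n.+1`!%:R.
  move=> s1; pose p : {poly R} := (n.+1`!%:R)^-1 *: 'X^(n.+1).
  pose g := horner p - s \*: h.
  have dp y : p^`().[y] = y ^+ n / n`!%:R.
    rewrite /p linearZ/= derivXn hornerZ hornerMn hornerXn factS natrM invfM.
    rewrite -[y ^+ _ *+ _]mulr_natr; field.
    by rewrite nat1r !pnatr_eq0 -lt0n fact_gt0.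
  have dg y : is_derive y (1 : R) g (y ^+ n / n`!%:R - s * dh y).
    by rewrite -dp; apply: is_deriveB.
  have [|c] := @MVT_segment R g (fun y => y ^+ n / n`!%:R - s * dh y) 0 x x0 (fun y _ => dg y).
    apply: derivable_within_continuous => y _.
    by have [] := dg y.
  rewrite in_itv/= => /andP[c0 cx]; rewrite subr0.
  have gE y : g y = p.[y] - s * h y by [].
  have p0 : p.[0] = 0 by rewrite /p hornerZ hornerXn expr0n/= mulr0.
  rewrite !gE h0 p0 mulr0 !subr0 => E.
  have <- : p.[x] = x ^+ n.+1 / n.+1`!%:R by rewrite /p hornerZ hornerXn mulrC.
  rewrite -subr_ge0 E mulr_ge0// subr_ge0.
  by rewrite (le_trans (ler_norm _))// normrM s1 mul1r bdh.
have [hx|hx] := leP 0 (h x).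
  by rewrite ger0_norm// -[leLHS]mul1r key// normr1.
by rewrite ltr0_norm// -mulN1r key// normrN1.
Qed.

Lemma le_norm_derive (R : realType) (h dh : R -> R) n :
  (forall x, is_derive x (1 : R) h (dh x)) -> h 0 = 0 ->
  (forall x, `|dh x| <= `|x| ^+ n / n`!%:R) ->
  forall x, `|h x| <= `|x| ^+ n.+1 / n.+1`!%:R.
Proof.
move=> hdh h0 bdh x; have [x0|x0] := leP 0 x.
  rewrite [X in _ <= X ^+ _ / _]ger0_norm//.
  apply: (le_norm_derive_pos hdh h0) => // y y0.
  by rewrite -[X in _ <= X ^+ _ / _](ger0_norm y0).
rewrite [X in _ <= X ^+ _ / _]ltr0_norm// -{1}[x]opprK.
apply: (@le_norm_derive_pos _ (h \o -%R) (fun y => dh (- y) * -1)) => [|y y0|].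
- by rewrite /= oppr0 h0.
- by rewrite mulrN1 normrN -[X in _ <= X ^+ _ / _](ger0_norm y0) -[X in _ <= `|X| ^+ _ / _]opprK normrN.
- by rewrite oppr_ge0 ltW.
Qed.

(** The phase b makes the induction work: the derivative of the remainder of order n+1 at phase b is
    the remainder of order n at phase b + pi / 2. *)
Lemma cos_taylor (R : realType) (b : R) n x :
  `|cos (x + b) - \sum_(i < n) cos (b + i%:R * (pi / 2)) / i`!%:R * x ^+ i| <=
  `|x| ^+ n / n`!%:R.
Proof.
elim: n b x => [|n IH] b x; first by rewrite big_ord0 subr0 expr0 fact0 divr1 cos_max.
pose p b n : {poly R} := \poly_(i < n) (cos (b + i%:R * (pi / 2)) / i`!%:R).
have pE b' n' y : \sum_(i < n') cos (b' + i%:R * (pi / 2)) / i`!%:R * y ^+ i = (p b' n').[y].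
  by rewrite horner_poly.
have dpE : (p b n.+1)^`() = p (b + pi / 2) n.
  rewrite /p poly_def raddf_sum/= big_ord_recl/= expr0 alg_polyC derivC add0r.
  rewrite poly_def; apply: eq_bigr => i _.
  rewrite linearZ/= derivXn/= -scalerMnr scalerMnl /bump/= add1n; congr (_ *: _).
  rewrite -[LHS]mulr_natr factS natrM.
  have -> : b + i.+1%:R * (pi / 2) = b + pi / 2 + i%:R * (pi / 2) by rewrite -natr1; ring.
  by field; rewrite nat1r !pnatr_eq0 -lt0n fact_gt0.
rewrite pE; apply: (@le_norm_derive _ (fun x => cos (x + b) - (p b n.+1).[x])
  (fun x => cos (x + (b + pi / 2)) - (p (b + pi / 2) n).[x])) => [y||y].
- apply: is_deriveB; last by rewrite -dpE; exact: is_derive_poly.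
  rewrite addrA cosDpihalf -[- sin _]mulr1.
  apply: (@is_derive1_comp _ cos (fun y => y + b)).
  by apply: is_derive_eq; rewrite addr0.
- rewrite horner_poly big_ord_recl/= expr0 mul0r addr0 add0r fact0 divr1 mulr1.
  by rewrite big1 ?addr0 ?subrr// => i _; rewrite /bump/= add1n expr0n mulr0.
- by rewrite -pE; exact: IH.
Qed.

(** Mean square distance from [a] of a binomial variable: squared bias plus variance. The centre is
    left free because the induction moves it to a - 1. *)
Lemma bernstein_moment2 (R : comPzRingType) (x a : R) n :
  \sum_(k < n.+1) 'C(n, k)%:R * (x ^+ k * (1 - x) ^+ (n - k) * (k%:R - a) ^+ 2) =
  (n%:R * x - a) ^+ 2 + n%:R * (x * (1 - x)).
Proof.
elim: n a => [|n IH] a.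
  by rewrite big_ord_recl big_ord0 bin0 subnn !expr0 /=; ring.
rewrite (sum_binS _ (fun k => x ^+ k * (1 - x) ^+ (n.+1 - k) * (k%:R - a) ^+ 2)).
have -> : \sum_(k < n.+1) 'C(n, k)%:R * (x ^+ k * (1 - x) ^+ (n.+1 - k) * (k%:R - a) ^+ 2) =
  (1 - x) * ((n%:R * x - a) ^+ 2 + n%:R * (x * (1 - x))).
  rewrite -IH mulr_sumr; apply: eq_bigr => k _.
  by rewrite subSn -1?ltnS// exprS; ring.
have -> : \sum_(k < n.+1) 'C(n, k)%:R *
    (x ^+ k.+1 * (1 - x) ^+ (n.+1 - k.+1) * (k.+1%:R - a) ^+ 2) =
  x * ((n%:R * x - (a - 1)) ^+ 2 + n%:R * (x * (1 - x))).
  rewrite -IH mulr_sumr; apply: eq_bigr => k _.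
  by rewrite subSS exprS -natr1; ring.
by rewrite -natr1; ring.
Qed.

Lemma bernstein_moment0 (R : comPzRingType) (x : R) n :
  \sum_(k < n.+1) 'C(n, k)%:R * (x ^+ k * (1 - x) ^+ (n - k)) = 1.
Proof.
rewrite -[RHS](expr1n _ n) -[X in _ = X ^+ _](subrK x 1) exprDn.
by apply: eq_bigr => k _; rewrite mulr_natl mulrC.
Qed.

Lemma segment_modulus (R : realType) (f : R -> R) (a b e : R) : continuous f ->
  0 < e -> exists2 d, 0 < d & forall x y, a <= x <= b -> `|x - y| < d ->
    `|f x - f y| < e.
Proof.
move=> cf e0; have /compact_near_coveringP K := @segment_compact R a b.
pose Q d := fun x => forall y, `|x - y| < d -> `|f x - f y| < e.
have KQ : \forall d \near (0 : R)^'+, `[a, b]%classic `<=` Q d.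
  apply: K => x _; have e2 : 0 < e / 2 by rewrite divr_gt0.
  have := cf x => /cvgrPdist_lt/(_ _ e2)/nbhs_ballP[r /= r0 hr].
  exists (ball x (r / 2), [set d | d < r / 2]).
    split; first by apply: nbhsx_ballx; rewrite divr_gt0.
    by apply: nbhs_right_lt; rewrite divr_gt0.
  move=> [x' d] [/= xx' dr] y xy; rewrite -(subrK (f x) (f x')) -addrA.
  rewrite (le_lt_trans (ler_normD _ _))// [e]splitr ltrD//.
    rewrite distrC; apply: hr; apply: lt_trans xx' _.
    by rewrite ltr_pdivrMr// mulr_natr mulr2n ltrDl.
  apply: hr; rewrite /ball/= -(subrK x' x) -addrA (le_lt_trans (ler_normD _ _))//.
  by rewrite [r]splitr ltrD// (lt_trans xy).
near (0 : R)^'+ => d; exists d => // x y xab.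
suff /(_ x) : `[a, b]%classic `<=` Q d by apply; rewrite /= in_itv.
by near: d.
Unshelve. all: by end_near. Qed.

(** The witness is the Bernstein polynomial of f. Averaging [quad] over the binomial weights leaves
    e / 2 plus 2 M / d^2 times the variance x (1 - x) / n. *)
Lemma weierstrass01 (R : realType) (f : R -> R) (M e : R) : continuous f ->
  (forall x, `|f x| <= M) -> 0 < e ->
  exists p : {poly R}, forall x, 0 <= x <= 1 -> `|f x - p.[x]| <= e.
Proof.
move=> cf fM e0; have e2 : 0 < e / 2 by rewrite divr_gt0.
have M0 : 0 <= M by apply: le_trans (fM 0).
have [d d0 hd] := @segment_modulus R f 0 1 _ cf e2.
(* Uniform continuity handles |x - y| < d; otherwise (x - y)^2 / d^2 >= 1 and the trivial bound 2 M
   suffices. *)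
have quad x y : 0 <= x <= 1 -> `|f x - f y| <= e / 2 + 2 * M / d ^+ 2 * (x - y) ^+ 2.
  move=> x01; have [xyd|dxy] := ltP `|x - y| d.
    rewrite (le_trans (ltW (hd x y x01 xyd)))// lerDl.
    by rewrite mulr_ge0 ?sqr_ge0// divr_ge0 ?sqr_ge0// mulr_ge0.
  rewrite (@le_trans _ _ (2 * M))//.
    by rewrite (le_trans (ler_normB _ _))//; have := fM x; have := fM y; lra.
  rewrite -[leLHS]add0r lerD ?(ltW e2)// mulrAC -mulrA ler_peMr ?mulr_ge0//.
  rewrite ler_pdivlMr ?exprn_gt0// mul1r -[leRHS]real_normK ?num_real//.
  by rewrite lerXn2r ?nnegrE ?(ltW d0).
pose c := 2 * M / d ^+ 2.
have c0 : 0 <= c by rewrite !mulr_ge0// invr_ge0 sqr_ge0.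
have [n n0 cn] : exists2 n, (0 : R) < n%:R & c / n%:R <= e / 2.
  exists (Num.bound (c / (e / 2))).+1; first by rewrite ltr0n.
  rewrite ler_pdivrMr ?ltr0n// mulrC -ler_pdivrMr//; apply: ltW.
  have /archi_boundP/lt_le_trans : 0 <= c / (e / 2) by rewrite divr_ge0 ?(ltW e2).
  by apply; rewrite ler_nat.
exists (\sum_(k < n.+1) (f (k%:R / n%:R) * 'C(n, k)%:R) *: ('X^k * (1 - 'X) ^+ (n - k))).
move=> x x01; have /andP[x0 x1] := x01; rewrite horner_sum.
have w0 k : 0 <= 'C(n, k)%:R * (x ^+ k * (1 - x) ^+ (n - k)).
  by rewrite mulr_ge0// mulr_ge0 ?exprn_ge0// subr_ge0.
have -> : f x = \sum_(k < n.+1) 'C(n, k)%:R * (x ^+ k * (1 - x) ^+ (n - k)) * f x.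
  by rewrite -mulr_suml bernstein_moment0 mul1r.
rewrite -sumrB (le_trans (ler_norm_sum _ _ _))//.
apply: (@le_trans _ _ (\sum_(k < n.+1) ('C(n, k)%:R * (x ^+ k * (1 - x) ^+ (n - k)) * (e / 2) +
   c / n%:R ^+ 2 * ('C(n, k)%:R * (x ^+ k * (1 - x) ^+ (n - k) * (k%:R - n%:R * x) ^+ 2))))).
  apply: ler_sum => k _.
  rewrite hornerZ hornerM hornerXn horner_exp hornerD hornerN hornerX hornerC.
  rewrite (_ : _ - _ = 'C(n, k)%:R * (x ^+ k * (1 - x) ^+ (n - k)) * (f x - f (k%:R / n%:R))); last by ring.
  rewrite normrM (ger0_norm (w0 k)).
  apply: (@le_trans _ _ ('C(n, k)%:R * (x ^+ k * (1 - x) ^+ (n - k)) *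
     (e / 2 + c * (x - k%:R / n%:R) ^+ 2))).
    by rewrite ler_wpM2l ?w0//; exact: quad.
  rewrite le_eqVlt; apply/orP; left; apply/eqP.
  by field; rewrite gt_eqF.
rewrite big_split/= -mulr_suml bernstein_moment0 mul1r -mulr_sumr bernstein_moment2.
rewrite subrr expr0n/= add0r -lerBrDl.
rewrite (_ : e - e / 2 = e / 2); last by field.
apply: le_trans cn; rewrite [leLHS](_ : _ = c / n%:R * (x * (1 - x))); last first.
  by field; rewrite gt_eqF.
rewrite (ler_piMr (divr_ge0 c0 (ltW n0)))//.
by rewrite mulr_ile1// ?subr_ge0// gerBl.
Qed.

Lemma weierstrass11 (R : realType) (f : R -> R) (M e : R) : continuous f ->
  (forall x, `|f x| <= M) -> 0 < e ->
  exists p : {poly R}, forall x, -1 <= x <= 1 -> `|f x - p.[x]| <= e.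
Proof.
move=> cf fM e0.
have [||p hp] := @weierstrass01 R (f \o (fun x => 2 * x - 1)) M e _ _ e0.
- move=> x; apply: continuous_comp; last exact: cf.
  by apply: cvgB; [apply: cvg_mulc; exact: cvg_id|exact: cvg_cst].
- by move=> x; exact: fM.
exists (p \Po (2^-1 *: ('X + 1%:P))) => x /andP[x1 x2].
rewrite horner_comp hornerZ hornerD hornerX hornerC.
have := hp (2^-1 * (x + 1)); rewrite /= (_ : 2 * _ - 1 = x); last by field.
apply; rewrite mulrC; apply/andP; split; first by apply: divr_ge0 => //; lra.
by rewrite ler_pdivrMr//; lra.
Qed.

(* [x |-> sin (x / (2 * A))] is injective on [-A, A], so that [f] is there a
   continuous function of it. *)
Lemma sin_poly_approx (R : realType) (f : R -> R) (M A e : R) : continuous f ->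
  (forall x, `|f x| <= M) -> 0 < A -> 0 < e ->
  exists t, exists p : {poly R}, forall x, `|f x - p.[sin (t * x)]| <=
    e + 2 * M / A ^+ 2 * x ^+ 2.
Proof.
move=> cf fM A0 e0.
have M0 : 0 <= M by apply: le_trans (fM 0).
have A2 : 0 < 2 * A by rewrite mulr_gt0.
have pi2 := @pihalf_ge1 R.
pose s : R := sin 2^-1.
have s0 : 0 <= s by rewrite sin_ge0_pi//; lra.
have s1 : s < 1.
  by rewrite /s -[ltRHS](@sin_pihalf R) ltr_sin// ?in_itv/=; lra.
(* Clipping to [-s, s] with s = sin (1/2) < 1 keeps the argument of [asin] strictly between -1 and
   1, so that F is continuous on the whole line. *)
pose cl x := Num.max (- s) (Num.min s x).
have clB x : - s <= cl x <= s.
  rewrite /cl le_max lexx/= ge_max ge_min lexx andbT/=; lra.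
have clK x : `|x| <= s -> cl x = x.
  rewrite ler_norml => /andP[h1 h2]; rewrite /cl.
  by rewrite (min_idPr h2) (max_idPr h1).
have ccl : continuous cl.
  move=> x; apply: (@continuous_max R R (cst (- s)) (cst s \min id)); first exact: cvg_cst.
  by apply: (@continuous_min R R (cst s) id); [exact: cvg_cst|exact: cvg_id].
pose F x := f (2 * A * asin (cl x)).
have cF : continuous F.
  move=> x; apply: (@continuous_comp _ _ _ (fun x => 2 * A * asin (cl x)) f); last exact: cf.
  apply: cvg_mulc; apply: continuous_comp; first exact: ccl.
  apply: continuous_asin; have := clB x; lra.
have [p hp] := weierstrass11 cF (fun x => fM _) e0.
exists (2 * A)^-1, p => x; have hs : -1 <= sin ((2 * A)^-1 * x) <= 1 by rewrite sin_geN1 sin_le1.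
have := hp _ hs; have [xA|Ax] := leP `|x| A => h.
  have xA1 : - 2^-1 <= (2 * A)^-1 * x <= 2^-1.
    rewrite -ler_norml normrM normfV (gtr0_norm A2) mulrC ler_pdivrMr//.
    by rewrite mulrA mulVf// mul1r.
  have xi : (2 * A)^-1 * x \in `[(- (pi / 2)), (pi / 2)] by rewrite in_itv/=; lra.
  have p1 := pi2.
  have e1 : (2^-1 : R) \in `[(- (pi / 2)), (pi / 2)] by rewrite in_itv/=; lra.
  have eN1 : (- 2^-1 : R) \in `[(- (pi / 2)), (pi / 2)] by rewrite in_itv/=; lra.
  have sm : {in `[(- (pi / 2)), (pi / 2)] &, {mono (@sin R) : x y / x <= y}}.
    by move=> u v hu hv; rewrite !leNgt ltr_sin.
  have ssx : `|sin ((2 * A)^-1 * x)| <= s.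
    by rewrite ler_norml -sinN !sm.
  move: h; rewrite /F clK// sinK// mulVKf ?gt_eqF// => /le_trans; apply.
  by rewrite lerDl mulr_ge0 ?sqr_ge0// divr_ge0 ?sqr_ge0// mulr_ge0.
rewrite -(subrK (F (sin ((2 * A)^-1 * x))) (f x)) -addrA (le_trans (ler_normD _ _))//.
rewrite [leRHS]addrC lerD//.
apply: (@le_trans _ _ (2 * M)).
  rewrite (le_trans (ler_normB _ _))//.
  by have := fM x; have := fM (2 * A * asin (cl (sin ((2 * A)^-1 * x)))); rewrite /F; lra.
rewrite mulrAC -mulrA ler_peMr ?mulr_ge0//.
rewrite ler_pdivlMr ?exprn_gt0// mul1r -[leRHS]real_normK ?num_real//.
by rewrite lerXn2r ?nnegrE ?(ltW A0)// ltW.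
Qed.

Lemma cvg_approx (R : realType) (x : nat -> R) (l : R) :
  (forall e, 0 < e -> exists u : nat -> R, exists l' : R,
    [/\ u n @[n --> \oo] --> l', \forall n \near \oo, `|x n - u n| <= e
      & `|l - l'| <= e]) ->
  x n @[n --> \oo] --> l.
Proof.
move=> H; apply/cvgrPdist_lt => e e0; have e4 : 0 < e / 4 by rewrite divr_gt0.
have [u [l' [/cvgrPdist_lt/(_ _ e4) ul' xu ll']]] := H _ e4.
near=> n.
have h1 : `|x n - u n| <= e / 4 by near: n.
have h2 : `|l' - u n| < e / 4 by near: n.
move: h1 h2 ll'; rewrite !ler_norml !ltr_norml; lra.
Unshelve. all: by end_near. Qed.

Section Rintegral_facts.
Context d (T : measurableType d) (R : realType).
Variable m : probability T R.
Implicit Types f g h : T -> R.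

Lemma Rintegral_prob_cst (c : R) : \int[m]_x c = c.
Proof. by rewrite Rintegral_cst//= probability_setT mulr1. Qed.

Lemma Rintegral_lincomb (I : eqType) (r : seq I) (c : I -> R) (g : I -> T -> R) :
  (forall i, i \in r -> m.-integrable setT (EFin \o g i)) ->
  m.-integrable setT (EFin \o (fun x => \sum_(i <- r) c i * g i x)) /\
  \int[m]_x (\sum_(i <- r) c i * g i x) = \sum_(i <- r) c i * \int[m]_x g i x.
Proof.
elim: r => [_|i r IHr ig].
  split; first by apply: eq_integrable (integrable0 _ _) => //= x _; rewrite big_nil.
  by under eq_Rintegral do rewrite big_nil; rewrite Rintegral_cst// mul0r big_nil.
have [j jr|IHi IH] := IHr; first by apply: ig; rewrite inE jr orbT.
have gi := ig i (mem_head _ _).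
have iZ : m.-integrable setT (EFin \o (fun x => c i * g i x)).
  by apply: eq_integrable (integrableZl _ (c i) gi) => //= x _; rewrite EFinM.
split.
  apply: eq_integrable (integrableD _ iZ IHi) => //= x _.
  by rewrite big_cons EFinD.
under eq_Rintegral do rewrite big_cons.
by rewrite RintegralD// RintegralZl// IH big_cons.
Qed.

Lemma dist_Rintegral f g h : m.-integrable setT (EFin \o f) ->
  m.-integrable setT (EFin \o g) -> m.-integrable setT (EFin \o h) ->
  (forall x, `|f x - g x| <= h x) ->
  `|\int[m]_x f x - \int[m]_x g x| <= \int[m]_x h x.
Proof.
move=> fi gi hi fgh.
have fgi : m.-integrable setT (EFin \o (fun x => f x - g x)).
  by apply: eq_integrable (integrableB _ fi gi) => //= x _; rewrite EFinB.
rewrite -RintegralB// (le_trans (le_normr_Rintegral _ fgi))//.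
by apply: le_Rintegral => //; exact: integrable_norm.
Qed.

Lemma bounded_integrable f M : measurable_fun setT f -> (forall x, `|f x| <= M) ->
  m.-integrable setT (EFin \o f).
Proof.
move=> mf fM; apply: (@le_integrable _ _ _ m setT _ _ (cst M%:E)) => //.
- exact/measurable_EFinP.
- by move=> x _; rewrite /= lee_fin (le_trans (fM x))// ler_norm.
- exact: finite_measure_integrable_cst.
Qed.

End Rintegral_facts.

Lemma cos_affine_continuous (R : realType) (a b : R) :
  continuous (fun x : R => cos (a * x + b)).
Proof.
move=> x; apply: (@continuous_comp _ _ _ (fun x => a * x + b) cos); last exact: continuous_cos.
by apply: cvgD; [apply: cvg_mulc; exact: cvg_id|exact: cvg_cst].
Qed.

Lemma sin_cos_bound (R : realType) (t : R) j a b x :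
  `|sin (t * x) ^+ j * cos (a * x + b)| <= 1.
Proof. by rewrite normrM mulr_ile1 ?cos_max// normrX exprn_ile1// sin_max. Qed.

Lemma sin_cos_continuous (R : realType) (t : R) j a b :
  continuous (fun x : R => sin (t * x) ^+ j * cos (a * x + b)).
Proof.
move=> x; apply: cvgM; last exact: cos_affine_continuous.
apply: (@continuous_comp _ _ _ (fun x => sin (t * x)) (fun x => x ^+ j)); last exact: exprn_continuous.
apply: (@continuous_comp _ _ _ (fun x => t * x) sin); last exact: continuous_sin.
by apply: cvg_mulc; exact: cvg_id.
Qed.

Section random_variable_facts.
Context d (T : measurableType d) (R : realType) (P : probability T R).
Variable Y : T -> R.
Hypothesis mY : measurable_fun setT Y.

Lemma bounded_continuous_integrable (f : R -> R) M : continuous f ->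
  (forall x, `|f x| <= M) -> P.-integrable setT (EFin \o (fun w => f (Y w))).
Proof.
move=> cf fM; apply: (@bounded_integrable _ _ _ _ _ M) => [|w]; last exact: fM.
by apply: measurableT_comp => //; exact: continuous_measurable_fun.
Qed.

Hypothesis Yi : forall k, P.-integrable setT (EFin \o (fun w => Y w ^+ k)).

(** The Taylor order is even so that |Y|^(2K) = Y^(2K) and the remainder is again a moment. *)
Lemma cos_moment_approx (a b : R) K :
  `|\int[P]_w cos (a * Y w + b) -
    \sum_(i < K.*2) cos (b + i%:R * (pi / 2)) / i`!%:R * a ^+ i * \int[P]_w (Y w ^+ i)| <=
  a ^+ K.*2 / K.*2`!%:R * \int[P]_w (Y w ^+ K.*2).
Proof.
pose c i := cos (b + i%:R * (pi / 2)) / i`!%:R * a ^+ i.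
have [ip <-] := @Rintegral_lincomb _ _ _ P _ (index_enum 'I_K.*2) c
  (fun (i : 'I_K.*2) w => Y w ^+ i) (fun i _ => Yi i).
have iZ : P.-integrable setT (EFin \o (fun w => a ^+ K.*2 / K.*2`!%:R * Y w ^+ K.*2)).
  by apply: eq_integrable (integrableZl _ (a ^+ K.*2 / K.*2`!%:R) (Yi K.*2)).
rewrite -RintegralZl//; apply: dist_Rintegral => //.
  apply: (@bounded_continuous_integrable (fun x => cos (a * x + b)) 1); last by move=> x; exact: cos_max.
  exact: cos_affine_continuous.
move=> w; have := cos_taylor b K.*2 (a * Y w).
have -> : `|a * Y w| ^+ K.*2 = a ^+ K.*2 * Y w ^+ K.*2.
  by rewrite -normrX ger0_norm ?exprn_even_ge0 ?odd_double// exprMn.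
rewrite mulrAC; congr (`|_ - _| <= _); apply: eq_bigr => i _.
by rewrite /c exprMn [LHS]mulrA.
Qed.

(** The formula for sin x cos y trades one power of the sine for a change of frequency and phase;
    repeated, it reduces powers of sines to single cosines. *)
Lemma sin_moment_split (t a b : R) j :
  \int[P]_w (sin (t * Y w) ^+ j.+1 * cos (a * Y w + b)) =
  2^-1 * (\int[P]_w (sin (t * Y w) ^+ j * cos ((t + a) * Y w + (b - pi / 2))) +
          \int[P]_w (sin (t * Y w) ^+ j * cos ((t - a) * Y w + (- b - pi / 2)))).
Proof.
have ii a' b' := bounded_continuous_integrable (@sin_cos_continuous R t j a' b')
  (@sin_cos_bound R t j a' b').
rewrite -RintegralD//; try exact: ii.
rewrite -RintegralZl//; last first.
  by apply: eq_integrable (integrableD _ (ii _ _) (ii _ _)) => //= w _; rewrite EFinD.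
apply: eq_Rintegral => w _; rewrite !addrA !cosBpihalf.
rewrite (_ : (t + a) * Y w + b = t * Y w + (a * Y w + b)); last by ring.
rewrite (_ : (t - a) * Y w - b = t * Y w - (a * Y w + b)); last by ring.
by rewrite sinD sinB exprSr; field.
Qed.

Lemma sin_poly_moment_approx (f : R -> R) (M t A e m2 : R) (p : {poly R}) :
  continuous f -> (forall x, `|f x| <= M) -> 0 <= M ->
  (forall x, `|f x - p.[sin (t * x)]| <= e / 2 + 2 * M / A ^+ 2 * x ^+ 2) ->
  2 * M / A ^+ 2 * m2 <= e / 2 -> \int[P]_w (Y w ^+ 2) <= m2 ->
  `|\int[P]_w f (Y w) - \sum_(i < size p) p`_i * \int[P]_w (sin (t * Y w) ^+ i)| <= e.
Proof.
move=> cf fM M0 hp hA mm2.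
have isin k : P.-integrable setT (EFin \o (fun w => sin (t * Y w) ^+ k)).
  have := bounded_continuous_integrable (@sin_cos_continuous R t k 0 0) (@sin_cos_bound R t k 0 0).
  by apply: eq_integrable => //= w _; rewrite mul0r addr0 cos0 mulr1.
have [ip <-] := @Rintegral_lincomb _ _ _ P _ (index_enum 'I_(size p))
  (fun i : 'I_(size p) => p`_i) (fun i w => sin (t * Y w) ^+ i) (fun i _ => isin i).
have iZ : P.-integrable setT (EFin \o (fun w => 2 * M / A ^+ 2 * Y w ^+ 2)).
  by apply: eq_integrable (integrableZl _ (2 * M / A ^+ 2) (Yi 2)).
have ic : P.-integrable setT (EFin \o cst (e / 2)).
  exact: finite_measure_integrable_cst.
apply: (@le_trans _ _ (\int[P]_w (e / 2 + 2 * M / A ^+ 2 * Y w ^+ 2))).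
  apply: dist_Rintegral => //.
  - exact: bounded_continuous_integrable cf fM.
  - by apply: eq_integrable (integrableD _ ic iZ) => //= w _; rewrite EFinD.
  - by move=> w; have := hp (Y w); rewrite horner_coef.
rewrite RintegralD// Rintegral_prob_cst RintegralZl; [|exact: measurableT|exact: Yi].
rewrite [leRHS]splitr lerD2l (le_trans _ hA)// ler_wpM2l//.
by rewrite divr_ge0 ?sqr_ge0// mulr_ge0.
Qed.

End random_variable_facts.

Section method_of_moments.
Context (R : realType) (d : nat -> measure_display) (T : forall n, measurableType (d n))
  (P : forall n, probability (T n) R) (Y : forall n, T n -> R).
Arguments Y : clear implicits.
Context d' (T' : measurableType d') (Q : probability T' R) (Z : T' -> R).
Hypothesis mY : forall n, measurable_fun setT (Y n).
Hypothesis mZ : measurable_fun setT Z.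
Hypothesis Yi : forall n k, (P n).-integrable setT (EFin \o (fun w => Y n w ^+ k)).
Hypothesis Zi : forall k, Q.-integrable setT (EFin \o (fun w => Z w ^+ k)).
Hypothesis YZ : forall k,
  \int[P n]_w (Y n w ^+ k) @[n --> \oo] --> \int[Q]_w (Z w ^+ k).
Hypothesis Z_growth : forall a : R,
  a ^+ K.*2 / K.*2`!%:R * \int[Q]_w (Z w ^+ K.*2) @[K --> \oo] --> 0.

(** The Taylor order is chosen from the moments of Z alone. It is then fixed, and convergence of the
    single moment of order 2K makes the remainder for Y n smaller than e for large n. *)
Let cos_cvg (a b : R) :
  \int[P n]_w cos (a * Y n w + b) @[n --> \oo] --> \int[Q]_w cos (a * Z w + b).
Proof.
apply: cvg_approx => e e0.
have [K hK] : exists K, a ^+ K.*2 / K.*2`!%:R * \int[Q]_w (Z w ^+ K.*2) < e.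
  have /cvgrPdist_lt/(_ _ e0) := Z_growth a; case=> K _ /(_ K (leqnn K)) /=.
  by rewrite sub0r normrN => /(le_lt_trans (ler_norm _)) h; exists K.
pose c i := cos (b + i%:R * (pi / 2)) / i`!%:R * a ^+ i.
exists (fun n => \sum_(i < K.*2) c i * \int[P n]_w (Y n w ^+ i)).
exists (\sum_(i < K.*2) c i * \int[Q]_w (Z w ^+ i)); split.
- by apply: cvg_sumr => i _; exact: cvg_mulc.
- have hc : a ^+ K.*2 / K.*2`!%:R * \int[P n]_w (Y n w ^+ K.*2) @[n --> \oo] -->
    a ^+ K.*2 / K.*2`!%:R * \int[Q]_w (Z w ^+ K.*2) by exact: cvg_mulc.
  apply: filterS (cvgr_lt _ hc _ hK) => n /ltW.
  by apply: (le_trans (cos_moment_approx _ _ _ _ _)) => //; exact: Yi.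
- by rewrite (le_trans _ (ltW hK))//; exact: cos_moment_approx.
Qed.

Let sin_cos_cvg (t : R) j (a b : R) :
  \int[P n]_w (sin (t * Y n w) ^+ j * cos (a * Y n w + b)) @[n --> \oo] -->
  \int[Q]_w (sin (t * Z w) ^+ j * cos (a * Z w + b)).
Proof.
elim: j a b => [|j IH] a b.
  rewrite (_ : (fun n => _) = (fun n => \int[P n]_w cos (a * Y n w + b))).
    by under eq_Rintegral do rewrite expr0 mul1r; exact: cos_cvg.
  by apply/funext => n; apply: eq_Rintegral => w _; rewrite expr0 mul1r.
rewrite sin_moment_split// (_ : (fun n => _) = (fun n => 2^-1 *
  (\int[P n]_w (sin (t * Y n w) ^+ j * cos ((t + a) * Y n w + (b - pi / 2))) +
   \int[P n]_w (sin (t * Y n w) ^+ j * cos ((t - a) * Y n w + (- b - pi / 2)))))).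
  by apply: cvg_mulc; apply: cvgD.
by apply/funext => n; exact: sin_moment_split.
Qed.

Lemma method_of_moments (f : R -> R) (M : R) : continuous f ->
  (forall x, `|f x| <= M) ->
  \int[P n]_w f (Y n w) @[n --> \oo] --> \int[Q]_w f (Z w).
Proof.
move=> cf fM; apply: cvg_approx => e e0.
have M0 : 0 <= M by apply: le_trans (fM 0).
have e2 : 0 < e / 2 by rewrite divr_gt0.
(* The extra 1 makes [m2] exceed the second moment of Y n for large n; A is then so large that the
   mean cost 2 M m2 / A^2 of leaving [-A, A] is at most e / 2. *)
pose m2 := \int[Q]_w (Z w ^+ 2) + 1.
have m20 : 0 < m2.
  by rewrite ltr_wpDl// Rintegral_ge0// => w _; exact: sqr_ge0.
pose A := Num.sqrt (2 * M * m2 / (e / 2)) + 1.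
have A0 : 0 < A by rewrite ltr_wpDl// sqrtr_ge0.
have hA : 2 * M / A ^+ 2 * m2 <= e / 2.
  rewrite mulrAC ler_pdivrMr ?exprn_gt0// [leRHS]mulrC -ler_pdivrMr//.
  have y0 : 0 <= 2 * M * m2 / (e / 2).
    by rewrite (divr_ge0 _ (ltW e2))// (mulr_ge0 _ (ltW m20))// mulr_ge0.
  rewrite -[leLHS](sqr_sqrtr y0).
  by rewrite lerXn2r ?nnegrE ?sqrtr_ge0 ?(ltW A0)// lerDl.
have [t [p hp]] := sin_poly_approx cf fM A0 e2.
exists (fun n => \sum_(i < size p) p`_i * \int[P n]_w (sin (t * Y n w) ^+ i)).
exists (\sum_(i < size p) p`_i * \int[Q]_w (sin (t * Z w) ^+ i)); split.
- apply: cvg_sumr => i _; apply: cvg_mulc; have := @sin_cos_cvg t i 0 0.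
  rewrite (_ : (fun n => _) = (fun n => \int[P n]_w (sin (t * Y n w) ^+ i))); last first.
    by apply/funext => n; apply: eq_Rintegral => w _; rewrite mul0r addr0 cos0 mulr1.
  by under eq_Rintegral do rewrite mul0r addr0 cos0 mulr1.
- have h : \int[Q]_w (Z w ^+ 2) < m2 by rewrite ltrDl.
  apply: filterS (cvgr_lt _ (@YZ 2) _ h) => n /ltW h2.
  by apply: (sin_poly_moment_approx _ _ cf fM M0 hp hA h2) => //; exact: Yi.
- by apply: (sin_poly_moment_approx _ _ cf fM M0 hp hA) => //; rewrite lerDl.
Qed.

End method_of_moments.

(** * Moments of the normal law *)

Section gaussian_moments.
Variable R : realType.
Local Notation mu := (@lebesgue_measure R).
Local Notation gauss := (@normal_prob R 0 1).
Local Notation p := (@normal_pdf R 0 1).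

Let gauss_dom : gauss `<< mu := normal_prob_dominates _ _.

Let density_ae : ae_eq mu setT (Radon_Nikodym_SigmaFinite.f gauss mu) (EFin \o p).
Proof.
apply: integral_ae_eq => //.
- exact: Radon_Nikodym_SigmaFinite.f_integrable.
- by apply/measurable_EFinP; exact: measurable_normal_pdf.
- by move=> A _ mA; rewrite -Radon_Nikodym_SigmaFinite.f_integral.
Qed.

Let integral_gauss_ge0 (f : R -> \bar R) : measurable_fun setT f ->
  (forall x, 0 <= f x)%E ->
  (\int[gauss]_x f x = \int[mu]_x (f x * (p x)%:E))%E.
Proof.
move=> mf f0.
rewrite -(Radon_Nikodym_SigmaFinite.change_of_variables gauss_dom f0)//.
apply: ae_eq_integral => //.
- apply: emeasurable_funM => //; apply: (measurable_int mu).
  exact: Radon_Nikodym_SigmaFinite.f_integrable.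
- apply: emeasurable_funM => //; apply/measurable_EFinP; exact: measurable_normal_pdf.
- exact: ae_eqe_mul2l density_ae.
Qed.

Let integral_gauss (f : R -> \bar R) : gauss.-integrable setT f ->
  (\int[gauss]_x f x = \int[mu]_x (f x * (p x)%:E))%E.
Proof.
move=> fi; have mf := measurable_int _ fi.
rewrite -(Radon_Nikodym_change_of_variables gauss_dom)//.
apply: ae_eq_integral => //.
- by apply: emeasurable_funM => //; apply: (measurable_int mu); exact: Radon_Nikodym_integrable.
- apply: emeasurable_funM => //; apply/measurable_EFinP; exact: measurable_normal_pdf.
- apply: ae_eqe_mul2l; apply: ae_eq_trans density_ae.
  by apply: ae_eq_sym; exact: ae_eq_Radon_Nikodym_SigmaFinite.
Qed.

(** Use |x|^k <= k! e^|x| <= k! (e^x + e^(-x)). Multiplying the standard density by e^(s x), s = 1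
    or -1, shifts its mean to s at the cost of a factor e^(1/2), so two normal densities
    dominate. *)
Let gauss_tail k (x : R) : `|x| ^+ k * p x <=
  k`!%:R * expR 2^-1 * (normal_pdf 1 1 x + normal_pdf (- 1) 1 x).
Proof.
have tilt s : s ^+ 2 = 1 -> expR (s * x) * p x = expR 2^-1 * normal_pdf s 1 x.
  move=> s2; rewrite !normal_pdfE ?oner_neq0// mulrCA [RHS]mulrCA; congr (_ * _).
  by rewrite /normal_fun -!expRD; congr expR; rewrite subr0 sqrrB s2 expr1n; field.
have p0 := @normal_pdf_ge0 R 0 1 x.
apply: (@le_trans _ _ (k`!%:R * (expR (1 * x) + expR (- 1 * x)) * p x)); last first.
  rewrite -[leLHS]mulrA mulrDl (tilt 1) ?expr1n// (tilt (-1)) ?sqrrN ?expr1n//.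
  by rewrite -mulrDr mulrA lexx.
rewrite ler_wpM2r// mulrC -ler_pdivrMr ?ltr0n ?fact_gt0//.
apply: (@le_trans _ _ (expR `|x|)).
  case: k => [|k]; first by rewrite expr0 fact0 divr1 -expR0 ler_expR.
  by apply: le_trans (expR_ge1Dxn k (normr_ge0 x)); rewrite lerDr ler01.
rewrite mul1r mulN1r; have [x0|x0] := leP 0 x.
  by rewrite ger0_norm// lerDl expR_ge0.
by rewrite ltr0_norm// lerDr expR_ge0.
Qed.

Let pdf_moment_integrable k : mu.-integrable setT (fun x => (x ^+ k * p x)%:E).
Proof.
apply: (@le_integrable _ _ _ mu setT _ _ (fun x => (k`!%:R * expR 2^-1)%:E *
  ((normal_pdf 1 1 x)%:E + (normal_pdf (- 1) 1 x)%:E)))%E => //.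
- apply/measurable_EFinP; apply: measurable_funM; first exact: exprn_measurable.
  exact: measurable_normal_pdf.
- move=> x _; rewrite /= lee_fin.
  rewrite normrM normrX (ger0_norm (normal_pdf_ge0 _ _ _)).
  by rewrite (le_trans (gauss_tail k x))// ler_norm.
- by apply: integrableZl => //; apply: integrableD => //; exact: integrable_normal_pdf.
Qed.

Lemma gauss_moment_integrable k :
  gauss.-integrable setT (EFin \o (fun x : R => x ^+ k)).
Proof.
have mk : measurable_fun [set: measurableTypeR R] (fun x : R => (x ^+ k)%:E).
  by apply/measurable_EFinP; exact: exprn_measurable.
apply/integrableP; split; first exact: mk.
rewrite integral_gauss_ge0//; last by apply: measurableT_comp.
have /integrableP[_] := pdf_moment_integrable k; congr (_ < _)%E.
apply: eq_integral => x _.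
by rewrite /= normrM (ger0_norm (normal_pdf_ge0 _ _ _)) EFinM.
Qed.

Let Rintegral_gauss k : \int[gauss]_x (x ^+ k) = \int[mu]_x (x ^+ k * p x).
Proof.
by rewrite /Rintegral (integral_gauss (gauss_moment_integrable k)).
Qed.

Let pdf_derive x : is_derive x (1 : R) p (- x * p x).
Proof.
pose q : {poly R} := - 2^-1 *: 'X^2.
have -> : p = @normal_peak R 1 \*: (expR \o horner q).
  apply/funext => y; rewrite normal_pdfE ?oner_neq0// /normal_fun !fctE/=.
  by congr (_ * expR _); rewrite /q hornerZ hornerXn subr0 expr1n; field.
have dq : q^`().[x] = - x.
  by rewrite /q linearZ/= derivXn/= hornerZ hornerMn hornerXn expr1 -[x *+ 2]mulr_natl; field.
have -> : - x * (normal_peak 1 \*: (expR \o horner q)) x =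
    normal_peak 1 *: (expR q.[x] * q^`().[x]).
  by rewrite dq !fctE/= /GRing.scale/=; ring.
by apply: is_deriveZ; exact: is_derive1_comp.
Qed.

(** Integration by parts: the derivative of F = x^k p is k x^(k-1) p - x^(k+1) p, and F vanishes at
    both ends. For k = 0 the factor 0 makes the value of [k.-1] irrelevant. *)
Let stein k : \int[gauss]_x (x ^+ k.+1) = k%:R * \int[gauss]_x (x ^+ k.-1).
Proof.
rewrite !Rintegral_gauss.
pose F x : R := x ^+ k * p x.
pose f x : R := k%:R * (x ^+ k.-1 * p x) - x ^+ k.+1 * p x.
have Ff x : is_derive x (1 : R) F (f x).
  have -> : F = horner 'X^k * p by apply/funext => y; rewrite /F !fctE hornerXn.
  apply: is_derive_eq (is_deriveM (is_derive_poly 'X^k x) (pdf_derive x)) _.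
  by rewrite derivXn hornerMn !hornerXn /f /GRing.scale/= exprS -[_ *+ k]mulr_natl; ring.
have fi : mu.-integrable setT (EFin \o f).
  have := integrableB _ (integrableZl _ k%:R (pdf_moment_integrable k.-1)) (pdf_moment_integrable k.+1).
  by move=> /(_ measurableT measurableT); apply: eq_integrable => // x _; rewrite /f /= EFinB EFinM.
have cF : continuous F.
  by move=> x; apply: differentiable_continuous; apply/derivable1_diffP; have [] := Ff x.
have cp : continuous p by apply: continuous_normal_pdf; rewrite oner_neq0.
have cf : continuous f.
  move=> x; apply: cvgB; last by apply: cvgM; [exact: exprn_continuous|exact: cp].
  by apply: cvg_mulc; apply: cvgM; [exact: exprn_continuous|exact: cp].
have FTC n : (\int[mu]_x ((f \_ `[(- n.+1%:R), n.+1%:R]) x)%:E = (F n.+1%:R - F (- n.+1%:R))%:E)%E.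
  rewrite EFinB -(continuous_FTC2 (f := f)) ?gtrN//.
  - by rewrite [RHS]integral_mkcond; apply: eq_integral => x _; rewrite restrict_EFin.
  - exact: continuous_subspaceT.
  - split; first by move=> x _; have [] := Ff x.
    + by apply: cvg_at_right_filter; exact: cF.
    + by apply: cvg_at_left_filter; exact: cF.
  - by move=> x _; rewrite derive1E; apply: derive_val.
have cv : (F n.+1%:R - F (- n.+1%:R))%:E @[n --> \oo] --> (\int[mu]_x (f x)%:E)%E.
  rewrite -(_ : (fun n => \int[mu]_x ((f \_ `[(- n.+1%:R), n.+1%:R]) x)%:E)%E =
     (fun n => (F n.+1%:R - F (- n.+1%:R))%:E)); last exact/funext.
  have [] := @dominated_convergence _ _ _ mu setT measurableT
    (fun n x => ((f \_ `[(- n.+1%:R), n.+1%:R]) x)%:E) (EFin \o f) (abse \o (EFin \o f)).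
  - move=> n; apply/measurable_EFinP; apply/(measurable_restrictT _ _).1 => //.
    apply: measurable_funTS; exact: continuous_measurable_fun.
  - by apply/measurable_EFinP; apply: continuous_measurable_fun.
  - apply: aeW => x _; apply: cvg_near_cst; near=> n.
    rewrite /= patchE ifT// inE/= in_itv/= -ler_norml.
    have : (Num.bound `|x| <= n)%N by near: n; exact: nbhs_infty_ge.
    move=> xn; apply: (le_trans (ltW (archi_boundP (normr_ge0 x)))).
    by rewrite ler_nat leqW.
  - exact: integrable_abse.
  - apply: aeW => x n _; rewrite /= patchE; case: ifP => _ //=.
    by rewrite normr0 lee_fin.
  - by [].
have c0 : F n.+1%:R - F (- n.+1%:R) @[n --> \oo] --> 0.
  (* [gauss_tail] one power higher, with each of the two densities bounded by its peak, gives |F y|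
     <= C / |y|. *)
  pose C := k.+1`!%:R * expR 2^-1 * (2 * @normal_peak R 1).
  have FC y : y != 0 -> `|F y| <= C / `|y|.
    move=> y0; rewrite ler_pdivlMr ?normr_gt0// /F normrM normrX mulrAC -exprSr.
    rewrite (ger0_norm (normal_pdf_ge0 _ _ _)) (le_trans (gauss_tail k.+1 y))//.
    rewrite ler_wpM2l ?mulr_ge0 ?expR_ge0// mulr_natl mulr2n.
    by rewrite lerD// normal_pdf_ub// oner_neq0.
  apply: (@squeeze_cvgr _ _ _ _ (fun n => - (2 * C * n.+1%:R^-1)) (fun n => 2 * C * n.+1%:R^-1)).
  - apply: nearW => n; rewrite -ler_norml (le_trans (ler_normB _ _))//.
    have n0 : (n.+1%:R : R) != 0 by rewrite pnatr_eq0.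
    have : - (n.+1%:R : R) != 0 by rewrite oppr_eq0.
    move=> /FC; have := FC _ n0; rewrite normrN normr_nat => h1 h2.
    by rewrite -mulrA mulr_natl mulr2n lerD.
  - rewrite -oppr0; apply: cvgN; rewrite -(mulr0 (2 * C)); apply: cvg_mulc.
    exact: cvg_harmonic.
  - by rewrite -(mulr0 (2 * C)); apply: cvg_mulc; exact: cvg_harmonic.
have /(congr1 fine) : (\int[mu]_x (f x)%:E = 0%:E)%E.
  rewrite -(cvg_lim (@ereal_hausdorff R) cv); apply: (cvg_lim (@ereal_hausdorff R)).
  by apply: cvg_EFin => //; apply: nearW.
rewrite -/(Rintegral mu setT f) /f RintegralB//.
- rewrite RintegralZl//; last exact: pdf_moment_integrable.
  by move=> /eqP; rewrite subr_eq0 => /eqP.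
- by apply: eq_integrable (integrableZl _ k%:R (pdf_moment_integrable k.-1)).
- exact: pdf_moment_integrable.
Unshelve. all: by end_near. Qed.

(** With one nonzero cumulant, of order 2 and equal to 1, the recursion reduces to the identity
    [stein]. *)
Lemma gauss_cumulant_rec :
  cumulant_rec (fun k => \int[gauss]_x (x ^+ k)) (fun j => (j == 2)%:R).
Proof.
case=> [|k].
  by rewrite big_ord_recl big_ord0/= mulr0 mul0r addr0 stein mul0r.
rewrite stein (bigD1 (Ordinal (isT : (1 < k.+2)%N)))//= big1 ?addr0.
  by rewrite bin1 mulr1 subn1.
by case=> -[|[|j]]//= hj _; rewrite mulr0 mul0r.
Qed.

Lemma gauss_moment0 : \int[gauss]_x (x ^+ 0) = 1.
Proof.
under eq_Rintegral do rewrite expr0.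
exact: (Rintegral_prob_cst (normal_prob 0 1 : probability (measurableTypeR R) R)).
Qed.

(** The moment of order 2K is (2K)! / (2^K K!), so the expression is the K-th term of the
    exponential series at a^2 / 2. *)
Lemma gauss_moment_growth (a : R) :
  a ^+ K.*2 / K.*2`!%:R * \int[gauss]_x (x ^+ K.*2) @[K --> \oo] --> 0.
Proof.
have f0 i : (i`!%:R : R) != 0 by rewrite pnatr_eq0 -lt0n fact_gt0.
have mE K : \int[gauss]_x (x ^+ K.*2) = K.*2`!%:R / (2 ^+ K * K`!%:R).
  elim: K => [|K IH]; first by rewrite gauss_moment0 mul1r mulr1 invr1.
  rewrite doubleS stein /= IH !factS !natrM exprS -[K.*2.+2]addn2 -[K.*2.+1]addn1.
  rewrite -[K.+1]addn1 !natrD -muln2 natrM.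
  by field; rewrite f0 expf_neq0//= -[1]/(1%:R) -natrD pnatr_eq0 addn1.
rewrite (_ : (fun K => _) = exp_coeff (a ^+ 2 / 2)).
  exact: cvg_series_cvg_0 (is_cvg_series_exp_coeff _).
apply/funext => K; rewrite mE /exp_coeff /= expr_div_n -exprM mulnC muln2.
by field; rewrite !f0 expf_neq0.
Qed.

End gaussian_moments.

(** * Joint cumulants and clustering *)

Section splittings.
Variables (A : eqType) (R : nmodType).

(* Sum of [F u v] over all ways to distribute the entries of [s] into two
   subsequences [u] and [v]. *)
Fixpoint split_sum (F : seq A -> seq A -> R) (s : seq A) : R :=
  if s is y :: s' then split_sum (fun u v => F (y :: u) v + F u (y :: v)) s'
  else F [::] [::].

Lemma eq_split_sum (F G : seq A -> seq A -> R) s :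
  (forall u v, perm_eq (u ++ v) s -> F u v = G u v) ->
  split_sum F s = split_sum G s.
Proof.
elim: s F G => [|y s IH] F G FG /=; first exact: FG.
apply: IH => u v uv; rewrite !FG//.
  by rewrite perm_catC /= perm_cons perm_catC.
by rewrite /= perm_cons.
Qed.

Lemma split_sumD (F G : seq A -> seq A -> R) s :
  split_sum (fun u v => F u v + G u v) s = split_sum F s + split_sum G s.
Proof.
elim: s F G => [//|y s IH] F G /=; rewrite -IH.
by apply: eq_split_sum => u v _; rewrite addrACA.
Qed.

Lemma split_sum_nilp (G : seq A -> seq A -> R) s :
  split_sum (fun u v => if nilp v then G u v else 0) s = G s [::].
Proof.
elim: s G => [//|y s IH] G /=.
rewrite -(IH (fun u v => G (y :: u) v)).
by apply: eq_split_sum => u v _; rewrite addr0.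
Qed.

(** Entries outside I are forced into v, where the filter erases them; what remains is a splitting
    of the entries in I. *)
Lemma split_sum_filter (I : pred A) (F : seq A -> seq A -> R) s :
  split_sum (fun u v => if all I u then F u (seq.filter I v) else 0) s =
  split_sum F (seq.filter I s).
Proof.
elim: s F => [//|y s IH] F /=; case: ifP => Iy /=.
  by rewrite -IH; apply: eq_split_sum => u v _; case: ifP; rewrite // addr0.
by rewrite -IH; apply: eq_split_sum => u v _; rewrite add0r.
Qed.

End splittings.

Lemma split_sum_mulr (A : eqType) (R : pzSemiRingType) (F : seq A -> seq A -> R) c s :
  split_sum F s * c = split_sum (fun u v => F u v * c) s.
Proof.
elim: s F => [//|y s IH] F /=; rewrite IH.
by apply: eq_split_sum => u v _; rewrite mulrDl.
Qed.

Lemma norm_split_sum_le (A : eqType) (R : numDomainType)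
    (F : seq A -> seq A -> R) c s :
  (forall u v, perm_eq (u ++ v) s -> `|F u v| <= c) ->
  `|split_sum F s| <= 2 ^+ size s * c.
Proof.
elim: s F c => [|y s IH] F c Fc /=; first by rewrite mul1r Fc.
rewrite exprSr -mulrA; apply: IH => u v uv.
rewrite (le_trans (ler_normD _ _))// mulr_natl mulr2n lerD// Fc//.
  by rewrite /= perm_cons.
by rewrite perm_catC /= perm_cons perm_catC.
Qed.

Section words.
Variables (A : eqType) (W : seq A).

Fixpoint words k : seq (seq A) :=
  if k is k'.+1 then [seq x :: s | x <- W, s <- words k'] else [:: [::]].

Lemma size_words k s : s \in words k -> size s = k /\ all (mem W) s.
Proof.
elim: k s => [|k IH] s /=; first by rewrite inE => /eqP->.
by move=> /allpairsP[[x t] /= [xW /IH[<- tW] ->]]; rewrite /= tW andbT.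
Qed.

Lemma sum_wordsS (R : nmodType) k (F : seq A -> R) :
  \sum_(s <- words k.+1) F s = \sum_(x <- W) \sum_(s <- words k) F (x :: s).
Proof. by rewrite /= big_allpairs_dep. Qed.

Lemma sum_words_prod (R : comPzSemiRingType) k (h : A -> R) :
  \sum_(s <- words k) \prod_(x <- s) h x = (\sum_(x <- W) h x) ^+ k.
Proof.
elim: k => [|k IH]; first by rewrite /= big_seq1 big_nil.
rewrite sum_wordsS exprS mulr_suml; apply: eq_bigr => x _.
by rewrite -IH mulr_sumr; apply: eq_bigr => s _; rewrite big_cons.
Qed.

(** For each choice of j among the k positions to form u, the words u and v range independently over
    all words of lengths j and k - j. *)
Lemma sum_words_split (R : comPzSemiRingType) k (f g : seq A -> R) :
  \sum_(s <- words k) split_sum (fun u v => f u * g v) s =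
  \sum_(j < k.+1) 'C(k, j)%:R * ((\sum_(s <- words j) f s) *
                                 (\sum_(s <- words (k - j)) g s)).
Proof.
elim: k f g => [|k IH] f g.
  by rewrite big_ord_recl big_ord0 /= !big_seq1 bin0 mul1r addr0.
rewrite sum_wordsS (sum_binS _ (fun j => (\sum_(s <- words j) f s) *
  (\sum_(s <- words (k.+1 - j)) g s))) addrC.
under eq_bigr do under eq_bigr do rewrite /= split_sumD.
under eq_bigr do rewrite big_split/= (IH (fun u => f (_ :: u)) g) (IH f (fun v => g (_ :: v))).
rewrite big_split/=; congr (_ + _).
  rewrite exchange_big/=; apply: eq_bigr => j _; rewrite -mulr_sumr; congr (_ * _).
  by rewrite sum_wordsS mulr_suml.
rewrite exchange_big/=; apply: eq_bigr => j _; rewrite -mulr_sumr; congr (_ * _).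
by rewrite subSn -1?ltnS// sum_wordsS mulr_sumr.
Qed.

End words.

Section joint_cumulants.
Variables (A : eqType) (R : realType).
Implicit Types (m : seq A -> R) (s : seq A).

(* Joint cumulant of the family indexed by the entries of [s], given the joint
   moments [m]; [n] bounds the recursion depth. *)
Fixpoint kappa_rec n m s : R :=
  if n isn't n'.+1 then 0 else if s is x :: s' then
    m s - split_sum (fun u v => if nilp v then 0 else kappa_rec n' m (x :: u) * m v) s'
  else 0.

Definition kappa m s := kappa_rec (size s) m s.

Let size_split (s u v : seq A) :
  perm_eq (u ++ v) s -> ~~ nilp v -> (size u < size s)%N.
Proof.
by move=> /perm_size; rewrite size_cat; case: v => // y v <- _; rewrite addnS ltnS leq_addr.
Qed.

Lemma kappa_rec_fuel n m s : (size s <= n)%N -> kappa_rec n m s = kappa m s.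
Proof.
suff H n1 n2 : (size s <= n1)%N -> (size s <= n2)%N -> kappa_rec n1 m s = kappa_rec n2 m s.
  by move=> sn; apply: H.
elim: n1 n2 s => [|n1 IH] [|n2] [|x s]//=; rewrite !ltnS => h1 h2.
congr (_ - _); apply: eq_split_sum => u v uv; case: ifPn => // v0.
have us := size_split uv v0.
by rewrite (IH n2)//= (leq_trans us).
Qed.

Lemma kappaE m x s : kappa m (x :: s) = m (x :: s) -
  split_sum (fun u v => if nilp v then 0 else kappa m (x :: u) * m v) s.
Proof.
rewrite {1}/kappa /=; congr (_ - _); apply: eq_split_sum => u v uv.
by case: ifPn => // v0; rewrite kappa_rec_fuel//=; exact: size_split uv v0.
Qed.

(** The expansion of a moment over set partitions, grouped by the block x :: u that contains x. The
    split with v empty is the cumulant [kappa m (x :: s)] itself. *)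
Lemma moment_split m x s : m [::] = 1 ->
  m (x :: s) = split_sum (fun u v => kappa m (x :: u) * m v) s.
Proof.
move=> m1; apply: (@addIr _ (- split_sum (fun u v => if nilp v then 0 else kappa m (x :: u) * m v) s)).
rewrite -kappaE -[LHS]mulr1 -m1 -(split_sum_nilp (fun u v => kappa m (x :: u) * m v)).
apply/eqP; rewrite eq_sym subr_eq -split_sumD; apply/eqP/eq_split_sum => u v _.
by case: ifP; rewrite ?addr0 ?add0r.
Qed.

(** Multilinearity: the cumulants of a sum of variables indexed by W are the joint cumulants summed
    over all words. *)
Lemma sum_kappa_rec m (W : seq A) : m [::] = 1 ->
  cumulant_rec (fun k => \sum_(s <- words W k) m s)
    (fun k => \sum_(s <- words W k) kappa m s).
Proof.
move=> m1 k; rewrite sum_wordsS.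
under eq_bigr do under eq_bigr do rewrite moment_split//.
under eq_bigr do rewrite (sum_words_split _ _ (fun u => kappa m (_ :: u)) m).
rewrite exchange_big; apply: eq_bigr => j _.
by rewrite sum_wordsS -mulr_sumr -mulrA mulr_suml.
Qed.

(** It follows [kappaE] term by term when all moments are at most B; the power of 2 bounds the
    number of splits. *)
Fixpoint kappa_bound (B : R) n : R :=
  if n is n'.+1 then B + 2 ^+ n * (kappa_bound B n' * B) + kappa_bound B n' else 0.

Lemma kappa_bound_ge0 B n : 0 <= B -> 0 <= kappa_bound B n.
Proof.
move=> B0; elim: n => [//|n IH] /=.
by rewrite !addr_ge0// !mulr_ge0// exprn_ge0.
Qed.

Lemma norm_kappa_le (Q : pred A) B n m s : 0 <= B ->
  (forall t, (size t <= n)%N -> all Q t -> `|m t| <= B) ->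
  (size s <= n)%N -> all Q s -> `|kappa m s| <= kappa_bound B n.
Proof.
move=> B0; elim: n s => [|n IH] s hm; first by case: s => // _ _; rewrite normr0.
have {}IH t : (size t <= n)%N -> all Q t -> `|kappa m t| <= kappa_bound B n.
  by apply: IH => t' t'n; apply: hm; exact: leqW.
case: s => [_ _|x s sn /= /andP[Qx Qs]].
  by rewrite normr0 (kappa_bound_ge0 n.+1).
have kn := kappa_bound_ge0 n B0.
rewrite kappaE (le_trans (ler_normB _ _))//.
rewrite -[leLHS]addr0 lerD//; apply: lerD; first by apply: hm; rewrite //= Qx.
apply: (@le_trans _ _ (2 ^+ size s * (kappa_bound B n * B))); last first.
  by rewrite ler_wpM2r ?mulr_ge0// ler_weXn2l ?ler1n// ltnW.
apply: norm_split_sum_le => u v uv; case: ifPn => v0.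
  by rewrite normr0 mulr_ge0.
have /andP[Qu Qv] : all Q u && all Q v by rewrite -all_cat (perm_all Q uv).
have us := size_split uv v0.
have vs : (size v <= size s)%N by rewrite -(perm_size uv) size_cat leq_addl.
rewrite normrM ler_pM//; first by apply: IH; rewrite /= ?Qx//; exact: leq_trans us sn.
by apply: hm => //; apply: leq_trans vs (leqW _).
Qed.

Fixpoint cluster_bound (B : R) n : R :=
  if n is n'.+1 then 1 + 2 ^+ n * (kappa_bound B n' + cluster_bound B n' * B)
    + cluster_bound B n' else 0.

Lemma cluster_bound_ge0 B n : 0 <= B -> 0 <= cluster_bound B n.
Proof.
move=> B0; elim: n => [//|n IH] /=.
by rewrite !addr_ge0// !mulr_ge0 ?exprn_ge0// addr_ge0 ?kappa_bound_ge0// mulr_ge0.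
Qed.

(* For moments that factorize exactly along [I] the cumulants of mixed families
   vanish; the bound below follows the errors through the recursion. *)
Lemma kappa_cluster (Q I : pred A) B e n m s : 0 <= B -> 0 <= e ->
  m [::] = 1 -> (forall t t', perm_eq t t' -> m t = m t') ->
  (forall t, (size t <= n)%N -> all Q t -> `|m t| <= B) ->
  (forall t, (size t <= n)%N -> all Q t ->
    `|m t - m (seq.filter I t) * m (seq.filter (predC I) t)| <= e) ->
  (size s <= n)%N -> all Q s -> has I s -> has (predC I) s ->
  `|kappa m s| <= cluster_bound B n * e.
Proof.
move=> B0 e0 m1 mp; elim: n I s => [|n IH] I s hm hc; first by case: s.
have {}IH I' t : (forall t, (size t <= n)%N -> all Q t ->
      `|m t - m (seq.filter I' t) * m (seq.filter (predC I') t)| <= e) ->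
    (size t <= n)%N -> all Q t -> has I' t -> has (predC I') t ->
    `|kappa m t| <= cluster_bound B n * e.
  by move=> h; apply: IH => // t' t'n; apply: hm; exact: leqW.
have hk t : (size t <= n)%N -> all Q t -> `|kappa m t| <= kappa_bound B n.
  by apply: norm_kappa_le => // t' t'n; apply: hm; exact: leqW.
case: s => [//|x s] sn; rewrite [all Q _]/= => /andP[Qx Qs].
(* The claim is symmetric in I and its complement, so x may be assumed to lie in I. *)
wlog Ix : I hc / I x => [hwlog|].
  have [Ix|nIx] := boolP (I x); first exact: hwlog hc Ix.
  move=> hI hJ; apply: (hwlog (predC I)) => //.
    move=> t tn Qt; rewrite mulrC (eq_filter (a2 := I)); first exact: hc.
    by move=> y /=; rewrite negbK.
  by rewrite (eq_has (a2 := I)) => // y /=; rewrite negbK.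
rewrite /= Ix /= => _ hJ; pose sI := seq.filter I s; pose sJ := seq.filter (predC I) s.
have kn := kappa_bound_ge0 n B0; have cn := cluster_bound_ge0 n B0.
have ke := mulr_ge0 kn e0; have cBe := mulr_ge0 (mulr_ge0 cn B0) e0.
have ce := mulr_ge0 cn e0.
(* Expand m (x :: sI) by [moment_split] and multiply by m sJ: by [split_sum_filter] this is a sum
   over the splits of all of s, to be compared term by term with the one in [kappaE]. *)
have -> : kappa m (x :: s) = (m (x :: s) - m (x :: sI) * m sJ) +
   split_sum (fun u v => (if all I u then kappa m (x :: u) * m (seq.filter I v) * m sJ else 0)
      - (if nilp v then 0 else kappa m (x :: u) * m v)) s.
  have spN (F : seq A -> seq A -> R) : split_sum (fun u v => - F u v) s = - split_sum F s.
    rewrite -[RHS]mulrN1 split_sum_mulr; apply: eq_split_sum => u v _.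
    by rewrite mulrN1.
  rewrite kappaE split_sumD spN addrA; congr (_ - _).
  rewrite (split_sum_filter I (fun u v => kappa m (x :: u) * m v * m sJ)).
  by rewrite -split_sum_mulr -moment_split// subrK.
have h1 : `|m (x :: s) - m (x :: sI) * m sJ| <= e.
  by have := hc (x :: s) sn; rewrite /= Qx Qs Ix; apply.
rewrite (le_trans (ler_normD _ _))// mulrDl mulrDl mul1r -[leLHS]addr0.
rewrite lerD// lerD//.
apply: (@le_trans _ _ (2 ^+ size s * ((kappa_bound B n + cluster_bound B n * B) * e))); last first.
  rewrite -mulrA ler_wpM2r ?ler_weXn2l ?ler1n//; last by exact: leqW (sn : (size s <= n)%N).
  by rewrite mulrDl addr_ge0.
apply: norm_split_sum_le => u v uv.
have /andP[Qu Qv] : all Q u && all Q v by rewrite -all_cat (perm_all Q uv).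
have vs : (size v <= size s)%N by rewrite -(perm_size uv) size_cat leq_addl.
(* With v empty, u has all entries of s, one of which is outside I, and both terms are 0. *)
rewrite [leRHS]mulrDl; case: (boolP (nilp v)) => v0.
  have -> : all I u = false.
    apply/negbTE; rewrite -has_predC; move: uv; rewrite (nilP v0) cats0.
    by move=> /perm_has ->.
  by rewrite subr0 normr0 addr_ge0.
have us := size_split uv v0.
have un : (size (x :: u) <= n)%N by exact: leq_trans us sn.
have Qxu : all Q (x :: u) by rewrite /= Qx.
(* If u lies in I, then v contains all of sJ and the clustering of v bounds the difference.
   Otherwise x :: u is mixed and shorter than x :: s, and the induction hypothesis applies. *)
case: ifPn => Iu.
  have -> : m sJ = m (seq.filter (predC I) v).
    apply: mp; have := perm_filter (predC I) uv; rewrite filter_cat perm_sym.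
    rewrite (_ : seq.filter (predC I) u = [::])//.
    apply/eqP; rewrite -[_ == _]negbK -has_filter has_predC negbK//.
  rewrite -mulrA -mulrBr normrM [X in _ * X]distrC -[leLHS]addr0 lerD//.
  by rewrite ler_pM ?hk// hc// (leq_trans vs (leqW sn)).
rewrite sub0r normrN normrM -[leLHS]add0r lerD//.
rewrite mulrAC ler_pM//; last by rewrite hm// (leq_trans vs (leqW sn)).
apply: (IH I) => //.
- by move=> t tn; apply: hc; exact: leqW.
- by rewrite /= Ix.
- by rewrite /= Ix/= has_predC.
Qed.

End joint_cumulants.

Lemma bigmax_attained (A : eqType) (f : A -> nat) s :
  (0 < \max_(y <- s) f y)%N -> exists2 y, y \in s & f y = \max_(y <- s) f y.
Proof.
elim: s => [|y s IH]; first by rewrite big_nil.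
rewrite big_cons; have [fy|fy] := leqP (f y) (\max_(z <- s) f z); last first.
  by exists y; rewrite ?mem_head.
by move=> /IH[z zs fz]; exists z; rewrite // inE zs orbT.
Qed.

Section gap.
Variables (A : eqType) (D : A -> A -> nat).
Hypothesis Dxx : forall x, D x x = 0%N.
Hypothesis Dtri : forall x y z, (D x z <= D x y + D y z)%N.

(* The [size s] numbers [(size s).+1 * D x y] cannot meet all the [(size s).+1]
   intervals ]j r, (j + 1) r]. *)
Lemma exists_gap x s r : r = \max_(y <- s) D x y -> (0 < r)%N ->
  exists I : pred A, [/\ I x, has (predC I) s &
    forall y y', y' \in s -> I y -> ~~ I y' -> (r <= (size s).+1 * D y y')%N].
Proof.
move=> rE r0; set k := (size s).+1.
(* For D x y > 0, [g y] is the j with k D x y in ]j r, (j + 1) r]; the predecessor closes the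
   interval on the right. *)
pose g y := ((k * D x y).-1 %/ r)%N.
have [j jk js] : exists2 j, (j < k)%N & j \notin map g s.
  have /allPn[j] : ~~ all (mem (map g s)) (iota 0 k).
    apply/negP => /allP /(uniq_leq_size (iota_uniq 0 k)).
    by rewrite size_iota size_map ltnn.
  by rewrite mem_iota => jk js; exists j.
have far y : y \in s -> (j * r < k * D x y)%N -> (j.+1 * r < k * D x y)%N.
  move=> ys jy; have gj : (j <= g y)%N by rewrite leq_divRL//; lia.
  have {}gj : (j < g y)%N.
    by rewrite ltn_neqAle gj andbT; apply: contraNneq js => ->; exact: map_f.
  by move: gj; rewrite leq_divRL//; lia.
exists (fun y => (k * D x y <= j * r)%N); split.
- by rewrite Dxx muln0.
- have [y ys yr] : exists2 y, y \in s & D x y = r by move: r0; rewrite rE; exact: bigmax_attained.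
  apply/hasP; exists y => //=; rewrite yr -ltnNge ltn_pmul2r//.
- move=> y y' y's Iy; rewrite -ltnNge => /(far _ y's).
  have := leq_mul2l k (D x y') (D x y + D y y'); rewrite Dtri orbT mulnDr mulSn; lia.
Qed.

End gap.

Lemma prod_powR_inv (A : eqType) (R : realType) (s : seq A) (a : R) (f : A -> R) :
  (0 < size s)%N -> 0 <= a -> (forall y, y \in s -> a <= f y) ->
  a <= \prod_(y <- s) f y `^ ((size s)%:R^-1).
Proof.
move=> s0 a0 af.
have -> : a = \prod_(y <- s) a `^ ((size s)%:R^-1).
  rewrite big_const_seq count_predT iter_mulr_1 -powR_mulrn ?powR_ge0// -powRrM.
  by rewrite mulVf ?powRr1// pnatr_eq0 -lt0n.
rewrite !big_seq; apply: ler_prod => y /af afy; rewrite powR_ge0 /=.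
by apply: ge0_ler_powR; rewrite ?nnegrE ?invr_ge0// (le_trans a0).
Qed.

Section tree_bound.
Variables (A : eqType) (R : realType) (D : A -> A -> nat) (m : seq A -> R).
Variables (W : seq A) (phi : R -> R) (c B C : R) (n : nat).
Hypothesis Dxx : forall x, D x x = 0%N.
Hypothesis Dtri : forall x y z, (D x z <= D x y + D y z)%N.
Hypothesis m1 : m [::] = 1.
Hypothesis mp : forall t t', perm_eq t t' -> m t = m t'.
Hypothesis phi01 : forall s, 0 <= s -> 0 <= phi s <= 1.
Hypothesis phi_ninc : forall s t, 0 <= s -> s <= t -> phi t <= phi s.
Hypotheses (c0 : 0 <= c) (B0 : 0 <= B) (C0 : 0 <= C).
Hypothesis mB : forall t, (size t <= n.+1)%N -> all (mem W) t -> `|m t| <= B.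
Hypothesis mcluster : forall (I : pred A) (r : nat) t, (size t <= n.+1)%N ->
  all (mem W) t ->
  (forall y y', y \in t -> y' \in t -> I y -> ~~ I y' -> (r <= n.+1 * D y y')%N) ->
  `|m t - m (seq.filter I t) * m (seq.filter (predC I) t)| <=
    C * phi (c * (r%:R / n.+1%:R)).

(** The value at 0 is 1 because phi 0 may be smaller, even 0, while a cumulant of coinciding points
    is only known to be bounded. Division by n + 1 reflects the gap of [exists_gap]. *)
Definition decay r : R := if r == 0%N then 1 else phi (c * (r%:R / n.+1%:R)).

Let arg_ge0 (r : nat) : 0 <= c * (r%:R / n.+1%:R) :> R.
Proof. by rewrite mulr_ge0// divr_ge0. Qed.

Lemma decay_ge0 r : 0 <= decay r.
Proof. by rewrite /decay; case: ifP => // _; case/andP: (phi01 (arg_ge0 r)). Qed.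

Lemma decay_ninc r r' : (r <= r')%N -> decay r' <= decay r.
Proof.
rewrite /decay; case: (eqVneq r 0%N) => [_ _|r0 rr'].
  by case: ifP => // _; case/andP: (phi01 (arg_ge0 r')).
rewrite ifF; last by apply/eqP => r'0; move: rr'; rewrite r'0 leqn0 (negPf r0).
by apply: phi_ninc => //; rewrite ler_wpM2l// ler_wpM2r ?invr_ge0// ler_nat.
Qed.

Let K := kappa_bound B n.+1 + cluster_bound B n.+1 * C.

Let norm_kappa_decay_max x s : x \in W -> all (mem W) s -> size s = n ->
  `|kappa m (x :: s)| <= K * decay (\max_(y <- s) D x y).
Proof.
move=> xW sW sn; set r := \max_(y <- s) _.
have xsn : (size (x :: s) <= n.+1)%N by rewrite /= sn.
have xsW : all (mem W) (x :: s) by rewrite /= sW andbT.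
have kb := kappa_bound_ge0 n.+1 B0; have cb := cluster_bound_ge0 n.+1 B0.
have [r0|r0] := eqVneq r 0%N.
  rewrite /decay r0 eqxx mulr1 (le_trans (norm_kappa_le B0 mB xsn xsW))//.
  by rewrite /K lerDl mulr_ge0.
rewrite -lt0n in r0; have {}[I [Ix hI gap]] := exists_gap Dxx Dtri (erefl r) r0.
have e0 : 0 <= C * phi (c * (r%:R / n.+1%:R)).
  by rewrite mulr_ge0//; case/andP: (phi01 (arg_ge0 r)).
rewrite /decay gtn_eqF//.
have : `|kappa m (x :: s)| <= cluster_bound B n.+1 * (C * phi (c * (r%:R / n.+1%:R))).
  (* The gap is known only among the entries of x :: s, so [kappa_cluster] is applied with
     membership there as Q. *)
  have memW t : all (mem (x :: s)) t -> all (mem W) t.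
    by move=> /allP h; apply/allP => y /h; exact: (allP xsW).
  apply: (@kappa_cluster _ _ (mem (x :: s)) I) => //.
  - by move=> t tn /memW; exact: mB.
  - move=> t tn ts; apply: mcluster => //; first exact: memW.
    move=> y y' _ /(allP ts) /= y's Iy nIy'; rewrite -sn; apply: gap => //.
    by move: y's; rewrite inE => /predU1P[y'x|//]; rewrite y'x Ix in nIy'.
  - by rewrite /= Ix.
  - by rewrite /= hI orbT.
move=> /le_trans; apply; rewrite mulrA ler_wpM2r//.
  by case/andP: (phi01 (arg_ge0 r)).
by rewrite /K lerDr.
Qed.

(** For each word, the decay at the largest distance is at most the product over its n entries of
    the n-th roots of the decays; the sum over words of a product is an n-th power. *)
Lemma sum_norm_kappa x S : x \in W ->
  \sum_(y <- W) decay (D x y) `^ (n%:R^-1) <= S ->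
  \sum_(s <- words W n) `|kappa m (x :: s)| <= K * S ^+ n.
Proof.
move=> xW hS.
have K0 : 0 <= K by rewrite addr_ge0 ?mulr_ge0 ?kappa_bound_ge0 ?cluster_bound_ge0.
apply: (@le_trans _ _ (\sum_(s <- words W n) K * \prod_(y <- s) decay (D x y) `^ (n%:R^-1))).
  rewrite !big_seq; apply: ler_sum => s /size_words[sn sW].
  rewrite (le_trans (norm_kappa_decay_max xW sW sn))// ler_wpM2l//.
  have [s0|s0] := posnP (size s).
    by rewrite (size0nil s0) !big_nil /decay.
  rewrite -sn; apply: prod_powR_inv => //; first exact: decay_ge0.
  move=> y ys; apply: decay_ninc.
  by rewrite (big_rem y)//= leq_maxl.
rewrite -mulr_sumr sum_words_prod ler_wpM2l//.
rewrite lerXn2r ?nnegrE//; last by rewrite (le_trans _ hS)// sumr_ge0// => y _; exact: powR_ge0.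
by apply: sumr_ge0 => y _; exact: powR_ge0.
Qed.

End tree_bound.

(** * Random fields on Cayley graphs *)

Lemma nat_minP (D : set nat) : D !=set0 ->
  D (nat_min D) /\ forall n, D n -> (nat_min D <= n)%N.
Proof.
move=> [n Dn]; rewrite /nat_min; case: pselect => [e|[]]; last first.
  by exists n; rewrite inE.
case: ex_minnP => k; rewrite inE => Dk kmin; split=> // j Dj.
by apply: kmin; rewrite inE.
Qed.

Section cayley_geometry.
Variables (V : groupType) (S : set V).
Hypothesis hS : cayley_data S.
Local Open Scope group_scope.

Let edge := cayley_edge S.

Let edge_trans (g x y : V) : edge (g * x) (g * y) = edge x y.
Proof. by rewrite /edge /cayley_edge invgM -mulgA mulKg. Qed.

Let path_trans (g x : V) p : path edge (g * x) (map ( *%g g) p) = path edge x p.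
Proof. by rewrite path_map; apply: eq_path => y z /=; rewrite edge_trans. Qed.

Let path_trans1 (g : V) p : path edge g (map ( *%g g) p) = path edge 1 p.
Proof. by rewrite -[RHS](path_trans g) mulg1. Qed.

Let last_trans1 (g : V) p : last g (map ( *%g g) p) = g * last 1 p.
Proof. by rewrite -[X in last X]mulg1 last_map. Qed.

(** The endpoints of paths from 1 form a subgroup, closed under inverses because S is symmetric; it
    contains S, hence is V. *)
Let reach1 (x : V) : exists p, path edge 1 p /\ last 1 p = x.
Proof.
have [_ _ [_ Ssym _] gen] := hS.
pose H := [set x | exists p, path edge 1 p /\ last 1 p = x].
suff : H = setT by move=> /seteqP[_ /(_ x I)].
have HS h : S h -> H h.
  move=> Sh; exists [:: h]; split=> //=; rewrite andbT /edge /cayley_edge.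
  by rewrite invg1 mul1g inE.
have HM y z : H y -> H z -> H (y * z).
  move=> [p [pp py]] [q [pq qz]]; exists (p ++ map ( *%g y) q).
  by rewrite cat_path pp py last_cat py path_trans1 last_trans1 qz pq.
apply: gen; last exact: HS.
split=> //; first by exists [::].
move=> y [p []]; elim/last_ind: p y => [|p z IH] y.
  by move=> _ <-; rewrite invg1; exists [::].
rewrite rcons_path last_rcons => /andP[pp ez] <-.
set g := last 1 p in ez; rewrite -[z](mulVKg g) invgM.
apply: HM; last exact: IH.
by apply: HS; apply/Ssym; rewrite invgK; move: ez; rewrite /edge /cayley_edge inE.
Qed.

Let reach (x y : V) : exists p, path edge x p /\ last x p = y.
Proof.
have [p [pp pl]] := reach1 (x^-1 * y); exists (map ( *%g x) p).
by rewrite path_trans1 last_trans1 pl mulVKg.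
Qed.

Let distP (x y : V) :
  (exists p, [/\ path edge x p, last x p = y & size p = cayley_dist S x y]) /\
  (forall p, path edge x p -> last x p = y -> (cayley_dist S x y <= size p)%N).
Proof.
have [|[p [pp pl] pd] dmin] := @nat_minP
    [set size p | p in [set p | path edge x p /\ last x p = y]].
  by have [p hp] := reach x y; exists (size p), p.
split; first by exists p.
by move=> q pq ql; apply: dmin; exists q.
Qed.

Lemma cayley_dist_refl x : cayley_dist S x x = 0%N.
Proof. by apply/eqP; rewrite -leqn0; apply: ((distP x x).2 [::]). Qed.

Lemma cayley_dist_triangle x y z :
  (cayley_dist S x z <= cayley_dist S x y + cayley_dist S y z)%N.
Proof.
have [[p [pp py <-]] _] := distP x y; have [[q [qp qz <-]] _] := distP y z.
by rewrite -size_cat; apply: (distP x z).2; rewrite ?cat_path ?last_cat py ?pp.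
Qed.

Lemma cayley_dist_eq0 x y : cayley_dist S x y = 0%N -> x = y.
Proof. by have [[p [_ <- <-]] _] := distP x y => /size0nil ->. Qed.

Lemma cayley_distE x y : cayley_dist S x y = cayley_len S (x^-1 * y).
Proof.
have le g u v : (cayley_dist S (g * u) (g * v) <= cayley_dist S u v)%N.
  have [[p [pp pl <-]] _] := distP u v.
  have := (distP (g * u) (g * v)).2 (map ( *%g g) p).
  by rewrite path_trans last_map pl size_map; apply.
apply/eqP; rewrite eqn_leq /cayley_len; apply/andP; split.
  by have := le x 1 (x^-1 * y); rewrite mulg1 mulVKg.
by have := le x^-1 x y; rewrite mulVg.
Qed.

Lemma cayley_ball_finite n : finite_set (cayley_ball S n).
Proof.
have [_ _ [Sfin _ _] _] := hS.
pose E k := [set x | exists p, [/\ path edge 1 p, last 1 p = x & (size p <= k)%N]].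
suff fE k : finite_set (E k).
  apply: sub_finite_set (fE n) => x /= xn.
  by have [[p [pp pl ps]] _] := distP 1 x; exists p; rewrite ps.
elim: k => [|k IH].
  apply: sub_finite_set (finite_set1 (1 : V)) => x [p [_ <-]].
  by rewrite leqn0 => /eqP/size0nil ->.
apply: (@sub_finite_set _ _ ([set 1] `|` [set h * x | h in S & x in E k])); last first.
  by rewrite finite_setU; split; [exact: finite_set1|exact: finite_image2].
move=> x [[|h p] [/=]]; first by move=> _ <-; left.
move=> /andP[eh pp] pl pk; right; exists h.
  by move: eh; rewrite /edge /cayley_edge invg1 mul1g inE.
exists (h^-1 * x); last by rewrite mulVKg.
exists (map ( *%g h^-1) p); split; last by rewrite size_map.
  by have := path_trans h^-1 h p; rewrite mulVg => ->.
by rewrite -[X in last X](mulVg h) last_map pl.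
Qed.

Lemma cayley_setdist_ge (A B : set V) r k : A !=set0 -> B !=set0 ->
  (forall x y, A x -> B y -> (r <= k * cayley_dist S x y)%N) ->
  (r <= k * cayley_setdist S A B)%N.
Proof.
move=> [x Ax] [y By] h; rewrite /cayley_setdist.
have [|[x' Ax' [y' By' <-]] _] := @nat_minP [set cayley_dist S x y | x in A & y in B].
  by exists (cayley_dist S x y), x => //; exists y.
exact: h.
Qed.

Lemma cayley_growth_unbounded N : exists n0, forall n, (n0 <= n)%N -> (N <= cayley_growth S n)%N.
Proof.
have [_ Vinf _ _] := hS.
have [B BV BN] := infinite_set_fset N Vinf.
exists (\max_(x <- enum_fset B) cayley_len S x) => n hn.
rewrite (leq_trans BN)// fsubset_leq_card//; apply/fsubsetP => x xB.
rewrite in_fset_set ?inE /cayley_ball /=; last exact: cayley_ball_finite.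
by apply: leq_trans hn; rewrite (big_rem x)//= leq_maxl.
Qed.

End cayley_geometry.

Lemma seq_max (A : eqType) (R : realDomainType) (f : A -> R) s : s != [::] ->
  exists2 y, y \in s & forall x, x \in s -> f x <= f y.
Proof.
elim: s => [//|y [|z s] IH] _.
  by exists y; rewrite ?mem_head// => x; rewrite inE => /eqP->.
have [//|t ts ht] := IH; have [fyt|fty] := leP (f y) (f t).
  by exists t; rewrite 1?inE ?ts ?orbT// => x; rewrite inE => /predU1P[->|/ht].
exists y; rewrite ?mem_head// => x; rewrite inE => /predU1P[->//|/ht/le_trans]; apply.
exact: ltW.
Qed.

(** The product is bounded by a power of its largest factor. This makes absolute moments of single
    variables control joint moments, in place of Hölder's inequality. *)
Lemma norm_prod_le (A : eqType) (R : realDomainType) (f : A -> R) s : s != [::] ->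
  `|\prod_(x <- s) f x| <= \sum_(x <- s) `|f x| ^+ size s.
Proof.
move=> s0; have [y ys fy] := seq_max (fun x => `|f x|) s0.
rewrite normr_prod (@le_trans _ _ (`|f y| ^+ size s))//.
  have -> : `|f y| ^+ size s = \prod_(x <- s) `|f y|.
    by rewrite big_const_seq count_predT iter_mulr_1.
  by rewrite !big_seq; apply: ler_prod => x /fy ->; rewrite normr_ge0.
by rewrite (big_rem y)//= lerDl sumr_ge0// => x _; rewrite exprn_ge0.
Qed.

Section field_joint_moments.
Variables (R : realType) (V : groupType) (S : set V).
Hypothesis hS : cayley_data S.
Variables (d : nat -> measure_display) (T : forall n, measurableType (d n)).
Variable P : forall n, probability (T n) R.
Variable X : forall n, V -> {RV P n >-> R}.
Hypothesis hmom : bounded_moments S X.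

Definition ball_seq n : seq V := enum_fset (fset_set (cayley_ball S n)).

Lemma mem_ball_seq n x : (x \in ball_seq n) = (x \in cayley_ball S n).
Proof. by rewrite -in_fset_set//; exact: cayley_ball_finite. Qed.

Lemma uniq_ball_seq n : uniq (ball_seq n).
Proof. exact: fset_uniq. Qed.

Definition joint_moment n s : R := \int[P n]_w (\prod_(x <- s) X n x w).

Let absolute_moments k : (0 < k)%N -> exists M, 0 <= M /\ forall n x, (0 < n)%N ->
  cayley_ball S n x -> (P n).-integrable setT (EFin \o (fun w => `|X n x w| ^+ k)) /\
  \int[P n]_w (`|X n x w| ^+ k) <= M.
Proof.
move=> k0; have k1 : 1 <= k%:R :> R by rewrite ler1n.
have := hmom k1; set s := ereal_sup _ => sy.
have Es n x : (0 < n)%N -> cayley_ball S n x ->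
    (\int[P n]_w (`|X n x w| ^+ k)%:E <= s)%E.
  move=> n0 xn; apply: (@le_trans _ _ (ereal_sup
      [set ('E_(P n)[(fun w => `|X n x w| `^ k%:R)%R])%E | x in cayley_ball S n])).
    apply: ereal_sup_ubound; exists x => //; rewrite unlock.
    by apply: eq_integral => w _; rewrite powR_mulrn.
  by apply: ereal_sup_ubound; exists n.
have E0 n x : (0 <= \int[P n]_w (`|X n x w| ^+ k)%:E)%E.
  by apply: integral_ge0 => w _; rewrite lee_fin exprn_ge0.
have s0 : (0 <= s)%E.
  apply: le_trans (E0 1%N 1%g) (Es 1%N 1%g _ _) => //.
  by rewrite /cayley_ball /= /cayley_len cayley_dist_refl.
have sf : s \is a fin_num by rewrite ge0_fin_numE.
exists (fine s); split; first exact: fine_ge0.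
move=> n x n0 xn; split.
  apply/integrableP; split.
    apply/measurable_EFinP; apply: measurable_funX; exact: measurableT_comp.
  apply: le_lt_trans sy; apply: le_trans (Es n x n0 xn); rewrite le_eqVlt; apply/orP; left.
  by apply/eqP/eq_integral => w _; rewrite /= ger0_norm// exprn_ge0.
rewrite /Rintegral fine_le//; last exact: Es.
by rewrite ge0_fin_numE// (le_lt_trans (Es n x n0 xn)).
Qed.

Let measurable_prod n s : measurable_fun setT (fun w => \prod_(x <- s) X n x w).
Proof.
elim: s => [|x s IH]; first by under eq_fun do rewrite big_nil; exact: measurable_cst.
by under eq_fun do rewrite big_cons; exact: measurable_funM.
Qed.

Let joint_moments k : exists B, 0 <= B /\ forall n s, (0 < n)%N ->
  all (mem (ball_seq n)) s -> size s = k ->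
  (P n).-integrable setT (EFin \o (fun w => \prod_(x <- s) X n x w)) /\
  `|joint_moment n s| <= B.
Proof.
case: k => [|k].
  exists 1; split=> // n s _ _ /size0nil ->; rewrite /joint_moment.
  split; last first.
    under eq_Rintegral do rewrite big_nil.
    by rewrite Rintegral_prob_cst normr1.
  under [X in EFin \o X]eq_fun do rewrite big_nil.
  exact: finite_measure_integrable_cst.
have [M [M0 hM]] := absolute_moments (ltn0Sn k).
exists (k.+1%:R * M); split; first exact: mulr_ge0.
move=> n s n0 sW sk.
have s0 : s != [::] by case: (s) sk.
have gi x : x \in s -> (P n).-integrable setT (EFin \o (fun w => `|X n x w| ^+ k.+1)) /\
  \int[P n]_w (`|X n x w| ^+ k.+1) <= M.
  by move=> xs; apply: hM => //; have := allP sW x xs; rewrite /= mem_ball_seq inE.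
have sumi : (P n).-integrable setT (EFin \o (fun w => \sum_(x <- s) `|X n x w| ^+ k.+1)) /\
    \int[P n]_w (\sum_(x <- s) `|X n x w| ^+ k.+1) <= (size s)%:R * M.
  elim: (s) gi => [_|y t IH gi].
    split; first by apply: eq_integrable (integrable0 _ _) => //= w _; rewrite big_nil.
    by under eq_Rintegral do rewrite big_nil; rewrite Rintegral_prob_cst mul0r.
  have [iy hy] := gi y (mem_head _ _).
  have [it ht] : (P n).-integrable setT (EFin \o (fun w => \sum_(x <- t) `|X n x w| ^+ k.+1)) /\
    \int[P n]_w (\sum_(x <- t) `|X n x w| ^+ k.+1) <= (size t)%:R * M.
    by apply: IH => x xt; apply: gi; rewrite inE xt orbT.
  split.
    by apply: eq_integrable (integrableD _ iy it) => //= w _; rewrite big_cons EFinD.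
  under eq_Rintegral do rewrite big_cons.
  by rewrite RintegralD// -nat1r mulrDl mul1r lerD.
have [si hs] := sumi.
have ip : (P n).-integrable setT (EFin \o (fun w => \prod_(x <- s) X n x w)).
  apply: le_integrable si => //; first by apply/measurable_EFinP; exact: measurable_prod.
  move=> w _; rewrite /= lee_fin -sk (le_trans (norm_prod_le _ s0))// ler_norm//.
split=> //; rewrite /joint_moment (le_trans (le_normr_Rintegral _ ip))//.
rewrite -sk; apply: le_trans hs; apply: le_Rintegral => //.
- exact: integrable_norm.
- by move=> w _; rewrite -sk; exact: norm_prod_le.
Qed.

Lemma joint_moment_nil n : joint_moment n [::] = 1.
Proof.
rewrite /joint_moment; under eq_Rintegral do rewrite big_nil.
by rewrite Rintegral_prob_cst.
Qed.

Lemma joint_moment_perm n s t : perm_eq s t -> joint_moment n s = joint_moment n t.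
Proof. by move=> st; apply: eq_Rintegral => w _; exact: perm_big. Qed.

Lemma joint_moment_integrable n s : (0 < n)%N -> all (mem (ball_seq n)) s ->
  (P n).-integrable setT (EFin \o (fun w => \prod_(x <- s) X n x w)).
Proof. by move=> n0 sW; have [B [_ /(_ n s n0 sW erefl)[]]] := joint_moments (size s). Qed.

Lemma joint_moment_bounded k : exists2 B, 0 <= B & forall n s, (0 < n)%N ->
  all (mem (ball_seq n)) s -> (size s <= k)%N -> `|joint_moment n s| <= B.
Proof.
elim: k => [|k [B B0 hB]].
  have [B [B0 hB]] := joint_moments 0; exists B => // n s n0 sW; rewrite leqn0 => /eqP s0.
  by have [] := hB n s n0 sW s0.
have [B' [B'0 hB']] := joint_moments k.+1; exists (B + B'); first exact: addr_ge0.
move=> n s n0 sW; rewrite leq_eqVlt => /predU1P[sk|sk].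
  by have [_ h] := hB' n s n0 sW sk; rewrite (le_trans h)// lerDr.
by rewrite (le_trans (hB n s n0 sW sk))// lerDl.
Qed.

End field_joint_moments.

Section cumulant_growth.
Variables (R : realType) (V : groupType) (S : set V).
Hypothesis hS : cayley_data S.
Variables (d : nat -> measure_display) (T : forall n, measurableType (d n)).
Variable P : forall n, probability (T n) R.
Variable X : forall n, V -> {RV P n >-> R}.
Hypothesis hmom : bounded_moments S X.
Variables (C c : nat -> R) (phi : R -> R).
Hypothesis hC : forall K : nat, (1 <= K)%N -> 0 < C K /\ 0 < c K.
Hypothesis hphi : fast_decreasing phi.
Hypothesis hsum : summable_in S phi.
Hypothesis hclust : clustering_mixed_moments S X C c phi.

(** The cumulant recursion involves subfamilies of every size up to k, and one pair of constants has
    to serve them all. *)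
Let uniform_constants k : exists C' c', [/\ 0 <= C', 0 < c' &
  forall K, (1 <= K <= k)%N -> C K <= C' /\ c' <= c K].
Proof.
elim: k => [|k [C' [c' [C0 c0 h]]]].
  exists 0, 1; split=> // K; rewrite leqn0 => /andP[K1 /eqP K0].
  by rewrite K0 in K1.
have [Ck ck] := hC (ltn0Sn k).
exists (C' + C k.+1), (Num.min c' (c k.+1)); split.
- by rewrite addr_ge0// ltW.
- by rewrite lt_min c0.
- move=> K /andP[K1]; rewrite leq_eqVlt => /predU1P[->|Kk].
    by split; [rewrite lerDr|rewrite ge_min lexx orbT].
  have /h[h1 h2] : (1 <= K <= k)%N by rewrite K1.
  by rewrite ge_min h2; split=> //; rewrite (le_trans h1)// lerDl ltW.
Qed.

Let expectationE n (f : T n -> R) : (P n).-integrable setT (EFin \o f) ->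
  ('E_(P n)[f])%E = (\int[P n]_w f w)%:E.
Proof. by move=> fi; rewrite unlock /Rintegral fineK// integrable_fin_num. Qed.

Let joint_moment_cluster k C' c' n (I : pred V) r t :
  0 <= C' -> 0 < c' -> (forall K, (1 <= K <= k.+1)%N -> C K <= C' /\ c' <= c K) ->
  (0 < n)%N -> (size t <= k.+1)%N -> all (mem (ball_seq S n)) t ->
  (forall y y', y \in t -> y' \in t -> I y -> ~~ I y' ->
    (r <= k.+1 * cayley_dist S y y')%N) ->
  `|joint_moment X n t - joint_moment X n (seq.filter I t) *
      joint_moment X n (seq.filter (predC I) t)| <=
  C' * phi (c' * (r%:R / k.+1%:R)).
Proof.
move=> C0 c0 Cc n0 tk tW gap; have [phi01 phin _] := hphi.
have arg0 : 0 <= c' * (r%:R / k.+1%:R) by rewrite mulr_ge0 ?divr_ge0// ltW.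
have rhs0 : 0 <= C' * phi (c' * (r%:R / k.+1%:R)).
  by rewrite mulr_ge0//; case/andP: (phi01 _ arg0).
set a := seq.filter I t; set b := seq.filter (predC I) t.
have abt : perm_eq (a ++ b) t by rewrite perm_sym -(perm_filterC I) perm_refl.
rewrite -(joint_moment_perm X n abt).
have [a0|a0] := posnP (size a).
  by rewrite (size0nil a0) joint_moment_nil mul1r subrr normr0.
have [b0|b0] := posnP (size b).
  by rewrite (size0nil b0) joint_moment_nil mulr1 cats0 subrr normr0.
(* Clustering is used with all exponents equal to 1; a point of multiplicity j in t is listed j
   times in z. *)
pose z (i : 'I_(size a + size b)) := nth 1%g (a ++ b) i.
have abW : all (mem (ball_seq S n)) (a ++ b) by rewrite (perm_all _ abt).
have zab i : z i \in a ++ b by apply: mem_nth; rewrite size_cat.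
have hz i : cayley_ball S n (z i).
  by have := allP abW _ (zab i); rewrite /= mem_ball_seq// inE.
have := @hclust n (size a) (size b) z (fun=> 1%N) n0 a0 b0 hz (fun=> isT).
have zl i : z (lshift (size b) i) = nth 1%g a i by rewrite /z nth_cat /= ltn_ord.
have zr i : z (rshift (size a) i) = nth 1%g b i.
  by rewrite /z nth_cat /= ltnNge leq_addr /= addKn.
have KE : (\sum_(i < size a + size b) 1)%N = size t.
  by rewrite sum1_card card_ord -size_cat (perm_size abt).
rewrite /= KE.
have intE s : all (mem (ball_seq S n)) s ->
    'E_(P n)[(fun w => \prod_(x <- s) X n x w)%R]%E = (joint_moment X n s)%:E.
  by move=> sW; apply: expectationE; exact: (joint_moment_integrable hS hmom).
have [aW bW] : all (mem (ball_seq S n)) a /\ all (mem (ball_seq S n)) b.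
  by move: abW; rewrite all_cat => /andP.
rewrite (_ : (fun w => \prod_(i < size a + size b) _) = (fun w => \prod_(x <- a ++ b) X n x w)); last first.
  by apply/funext => w; rewrite (big_nth 1%g) size_cat big_mkord.
rewrite (_ : (fun w => \prod_(i < size a) _) = (fun w => \prod_(x <- a) X n x w)); last first.
  by apply/funext => w; rewrite (big_nth 1%g) big_mkord; apply: eq_bigr => i _; rewrite zl.
rewrite (_ : (fun w => \prod_(i < size b) _) = (fun w => \prod_(x <- b) X n x w)); last first.
  by apply/funext => w; rewrite (big_nth 1%g) big_mkord; apply: eq_bigr => i _; rewrite zr.
rewrite !intE// lee_fin => /le_trans; apply.
set s := cayley_setdist _ _ _.
have rs : (r <= k.+1 * s)%N.
  apply: cayley_setdist_ge.
  - by exists (z (lshift (size b) (Ordinal a0))), (Ordinal a0).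
  - by exists (z (rshift (size a) (Ordinal b0))), (Ordinal b0).
  - move=> x y [i _ <-] [j _ <-]; rewrite zl zr.
    have := mem_nth 1%g (ltn_ord i); have := mem_nth 1%g (ltn_ord j).
    by rewrite !mem_filter => /andP[h1 h2] /andP[h3 h4]; exact: gap.
have t1 : (1 <= size t <= k.+1)%N.
  by rewrite tk andbT -(perm_size abt) size_cat (leq_trans a0)// leq_addr.
have [hC' hc'] := Cc _ t1.
have [C1 c1] := hC (proj1 (andP t1)).
have phi0 : 0 <= phi (c (size t) * s%:R).
  by have /phi01/andP[] : 0 <= c (size t) * s%:R by rewrite mulr_ge0// ltW.
apply: ler_pM => //; first exact: ltW.
apply: phin => //; apply: ler_pM => //; first exact: ltW.
by rewrite ler_pdivrMr// mulrC -natrM ler_nat.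
Qed.

(** Translation by the inverse of x turns the sum over the ball into part of the series that
    [summable_in] bounds with p = k. The extra 1 comes from y = x, where [decay] is 1. *)
Let decay_sum k c' : (0 < k)%N -> 0 < c' -> exists M, forall n x, x \in ball_seq S n ->
  \sum_(y <- ball_seq S n) decay phi c' k (cayley_dist S x y) `^ (k%:R^-1) <= M.
Proof.
move=> k0 c0; have [phi01 phin _] := hphi.
pose g z := phi (c' / k.+1%:R * (cayley_len S z)%:R) `^ (k%:R^-1).
have g0 z : 0 <= g z by exact: powR_ge0.
pose M := (\esum_(z in [set: V]) (g z)%:E)%E.
have My : (M < +oo)%E by apply: hsum; rewrite ?divr_gt0// ler1n.
have M0 : (0 <= M)%E by apply: esum_ge0 => z _; rewrite lee_fin.
exists (1 + fine M) => n x xW.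
apply: (@le_trans _ _ (\sum_(y <- ball_seq S n) ((y == x)%:R + g (x^-1 * y)%g))).
  apply: ler_sum => y _; rewrite /decay; case: eqVneq => [/(cayley_dist_eq0 hS) ->|_].
    by rewrite powR1 eqxx lerDl.
  rewrite /g -cayley_distE//.
  have -> : c' * ((cayley_dist S x y)%:R / k.+1%:R) = c' / k.+1%:R * (cayley_dist S x y)%:R.
    by rewrite mulrA mulrAC.
  by rewrite lerDr.
rewrite big_split/= lerD//.
  under eq_bigr do rewrite mulrb.
  by rewrite -big_mkcond/= -big_filter filter_pred1_uniq ?uniq_ball_seq// big_seq1.
rewrite -lee_fin fineK ?ge0_fin_numE// -sumEFin.
apply: esum_ge; exists [set` map ( *%g x^-1%g) (ball_seq S n)]; first by split=> //; exact: finite_seq.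
rewrite -fsbig_seq; first by rewrite big_map.
by rewrite map_inj_uniq ?uniq_ball_seq//; exact: mulgI.
Qed.

Lemma sum_kappa_growth k : exists B, forall n, (0 < n)%N ->
  `|\sum_(s <- words (ball_seq S n) k.+1) kappa (joint_moment X n) s| <=
  B * (cayley_growth S n)%:R.
Proof.
have [phi01 phin _] := hphi.
have [C' [c' [C0 c0 hCc]]] := uniform_constants k.+1.
have [B B0 hB] := joint_moment_bounded hS hmom k.+1.
pose K := kappa_bound B k.+1 + cluster_bound B k.+1 * C'.
suff [M hM] : exists M, forall n x, (0 < n)%N -> x \in ball_seq S n ->
    \sum_(s <- words (ball_seq S n) k) `|kappa (joint_moment X n) (x :: s)| <= M.
  exists M => n n0; rewrite sum_wordsS (le_trans (ler_norm_sum _ _ _))//.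
  apply: (@le_trans _ _ (\sum_(x <- ball_seq S n) M)).
    rewrite !big_seq; apply: ler_sum => x xW.
    by rewrite (le_trans (ler_norm_sum _ _ _))// hM.
  by rewrite big_const_seq count_predT iter_addr_0 mulr_natr.
have key n x M : (0 < n)%N -> x \in ball_seq S n ->
  \sum_(y <- ball_seq S n) decay phi c' k (cayley_dist S x y) `^ (k%:R^-1) <= M ->
  \sum_(s <- words (ball_seq S n) k) `|kappa (joint_moment X n) (x :: s)| <= K * M ^+ k.
  move=> n0 xW; apply: sum_norm_kappa => //.
  - exact: cayley_dist_refl.
  - exact: cayley_dist_triangle.
  - exact: joint_moment_nil.
  - exact: joint_moment_perm.
  - exact: ltW.
  - by move=> t tk tW; exact: hB.
  - by move=> I r t tk tW gap; exact: joint_moment_cluster.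
(* Summability needs p = k >= 1; for k = 0 the power M^k is 1 whatever M is. *)
have [k0|k0] := posnP k.
  have uk u : u ^+ k = 1 :> R by rewrite k0.
  exists K => n x n0 xW.
  by have := key n x _ n0 xW (lexx _); rewrite uk mulr1.
have [M hM] := decay_sum k0 c0.
by exists (K * M ^+ k) => n x n0 xW; apply: key => //; exact: hM.
Qed.

End cumulant_growth.

(** * Moments and cumulants of affine images of the field sums *)

Lemma bin_trinomial k l j : (l + j <= k)%N ->
  ('C(k, l + j) * 'C(l + j, j) = 'C(k, j) * 'C(k - j, l))%N.
Proof.
move=> ljk; have jk : (j <= k)%N by apply: leq_trans ljk; rewrite leq_addl.
have lk : (l <= k - j)%N by rewrite leq_subRL// addnC.
have := bin_fact lk; rewrite -subnDA [(j + l)%N]addnC => h2.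
have := bin_fact (leq_addl l j); rewrite addnK => h1.
apply/eqP; rewrite -(@eqn_pmul2r (j`! * l`! * (k - (l + j))`!)) ?muln_gt0 ?fact_gt0//.
apply/eqP; transitivity k`!.
  by rewrite -(bin_fact ljk) -h1 !mulnA.
by rewrite -(bin_fact jk) -h2; lia.
Qed.

(* If [m] lists the moments of [Y], the new sequence lists those of [Y - a]. *)
Lemma cumulant_rec_shift (R : comPzRingType) (m tau : nat -> R) (a : R) :
  cumulant_rec m tau ->
  cumulant_rec (fun k => \sum_(l < k.+1) 'C(k, l)%:R * ((- a) ^+ (k - l) * m l))
    (fun j => if j == 1%N then tau 1%N - a else tau j).
Proof.
move=> mtau k; pose c k := \sum_(l < k.+1) 'C(k, l)%:R * ((- a) ^+ (k - l) * m l).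
(* Pascal's rule splits off - a c_k, which is exactly the effect of lowering the first cumulant by
   a. The remaining double sums agree by [bin_trinomial]. *)
have c_pascal : c k.+1 = - a * c k +
    \sum_(i < k.+1) 'C(k, i)%:R * ((- a) ^+ (k - i) * m i.+1).
  rewrite /c (sum_binS _ (fun l => (- a) ^+ (k.+1 - l) * m l)); congr (_ + _).
  rewrite mulr_sumr; apply: eq_bigr => i _.
  by rewrite subSn -1?ltnS// exprS; ring.
have tauE : \sum_(j < k.+1) 'C(k, j)%:R * (if j.+1 == 1%N then tau 1%N - a else tau j.+1) * c (k - j)%N =
    - a * c k + \sum_(j < k.+1) 'C(k, j)%:R * tau j.+1 * c (k - j)%N.
  rewrite !big_ord_recl /= bin0 subn0 addrA; congr (_ + _); ring.
rewrite -/(c k.+1) c_pascal tauE; congr (_ + _).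
pose F j l := 'C(k, j)%:R * tau j.+1 * ('C(k - j, l)%:R * ((- a) ^+ (k - j - l) * m l)).
transitivity (\sum_(0 <= i < k.+1) \sum_(0 <= j < i.+1) F j (i - j)%N); last first.
  rewrite sum_triangle big_mkord; apply: eq_bigr => j _.
  rewrite /c mulr_sumr subSn -1?ltnS// big_mkord; exact: eq_bigr.
rewrite big_mkord; apply: eq_bigr => i _; have ik : (i <= k)%N by rewrite -ltnS.
rewrite mtau big_mkord !mulr_sumr; apply: eq_bigr => j _.
have ji : (j <= i)%N by rewrite -ltnS.
have := @bin_trinomial k (i - j) j; rewrite subnK// => /(_ ik)/(congr1 (fun n => n%:R : R)).
rewrite !natrM /F => E; rewrite subnBA// subnK; last exact: leq_trans ik.
transitivity ('C(k, i)%:R * 'C(i, j)%:R * ((- a) ^+ (k - i) * (tau j.+1 * m (i - j)%N))); first by ring.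
by rewrite E; ring.
Qed.

Lemma cumulant_rec_scale (R : fieldType) (m tau : nat -> R) (s : R) : s != 0 ->
  cumulant_rec m tau ->
  cumulant_rec (fun k => m k / s ^+ k) (fun k => tau k / s ^+ k).
Proof.
move=> s0 mtau k; rewrite mtau mulr_suml; apply: eq_bigr => j _.
have -> : s ^+ k.+1 = s ^+ j.+1 * s ^+ (k - j).
  by rewrite -exprD addSn subnKC// -ltnS.
by field; rewrite !expf_neq0.
Qed.

Lemma cumulant_rec_uniq (R : pzSemiRingType) (m m' tau : nat -> R) :
  m 0%N = m' 0%N -> cumulant_rec m tau -> cumulant_rec m' tau -> m =1 m'.
Proof.
move=> m0 h h'; elim/ltn_ind => -[//|k] IH.
by rewrite h h'; apply: eq_bigr => j _; rewrite IH// ltnS leq_subr.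
Qed.

Lemma eq_cumulant_rec (R : pzSemiRingType) (m m' tau tau' : nat -> R) :
  m =1 m' -> (forall j, tau j.+1 = tau' j.+1) ->
  cumulant_rec m tau -> cumulant_rec m' tau'.
Proof.
by move=> mm' tt h k; rewrite -mm' h; apply: eq_bigr => j _; rewrite tt mm'.
Qed.

Lemma moments_hankel_psd (R : realType) d (T : measurableType d)
    (P : probability T R) (Y : T -> R) :
  (forall k, P.-integrable setT (EFin \o (fun w => Y w ^+ k))) ->
  hankel_psd (fun k => \int[P]_w (Y w ^+ k)).
Proof.
move=> Yi f K.
have inner i := @Rintegral_lincomb _ _ _ P _ (index_iota 0 K) (fun j => f i * f j)
  (fun j w => Y w ^+ (i + j)) (fun j _ => Yi (i + j)%N).
have [_ outer] := @Rintegral_lincomb _ _ _ P _ (index_iota 0 K) (fun=> 1)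
  (fun i w => \sum_(0 <= j < K) f i * f j * Y w ^+ (i + j)) (fun i _ => (inner i).1).
rewrite (_ : \sum_(0 <= i < K) _ = \sum_(0 <= i < K) 1 *
   \int[P]_w (\sum_(0 <= j < K) f i * f j * Y w ^+ (i + j))); last first.
  by apply: eq_bigr => i _; rewrite mul1r (inner i).2.
rewrite -outer; apply: Rintegral_ge0 => w _.
rewrite (_ : \sum_(0 <= i < K) _ = (\sum_(0 <= i < K) f i * Y w ^+ i) ^+ 2) ?sqr_ge0//.
rewrite expr2 mulr_suml; apply: eq_bigr => i _; rewrite mul1r mulr_sumr.
by apply: eq_bigr => j _; rewrite exprD; ring.
Qed.

Section field_sum_moments.
Variables (R : realType) (V : groupType) (S : set V).
Hypothesis hS : cayley_data S.
Variables (d : nat -> measure_display) (T : forall n, measurableType (d n)).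
Variable P : forall n, probability (T n) R.
Variable X : forall n, V -> {RV P n >-> R}.
Hypothesis hmom : bounded_moments S X.

Definition sum_moment n k : R := \sum_(s <- words (ball_seq S n) k) joint_moment X n s.

Definition sum_cumulant n k : R :=
  \sum_(s <- words (ball_seq S n) k) kappa (joint_moment X n) s.

Lemma sum_moment0 n : sum_moment n 0 = 1.
Proof. by rewrite /sum_moment /= big_seq1 joint_moment_nil. Qed.

Lemma sum_moment_rec n : cumulant_rec (sum_moment n) (sum_cumulant n).
Proof. by apply: sum_kappa_rec; exact: joint_moment_nil. Qed.

Lemma field_sumE n w : field_sum S X n w = \sum_(x <- ball_seq S n) X n x w.
Proof.
rewrite /field_sum fsbig_finite; last exact: cayley_ball_finite.
by rewrite /= /ball_seq; elim/big_rec2: _ => [//|x y f _ <-].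
Qed.

Lemma field_sum_moment n k : (0 < n)%N ->
  (P n).-integrable setT (EFin \o (fun w => field_sum S X n w ^+ k)) /\
  \int[P n]_w (field_sum S X n w ^+ k) = sum_moment n k.
Proof.
move=> n0.
have [|iw Ew] := @Rintegral_lincomb _ _ _ (P n) _ (words (ball_seq S n) k) (fun=> 1)
   (fun s w => \prod_(x <- s) X n x w).
  by move=> s /size_words[_ sW]; exact: (joint_moment_integrable hS hmom).
have E w : field_sum S X n w ^+ k =
    \sum_(s <- words (ball_seq S n) k) 1 * \prod_(x <- s) X n x w.
  by rewrite field_sumE -sum_words_prod; apply: eq_bigr => s _; rewrite mul1r.
split; first by apply: eq_integrable iw => //= w _; rewrite E.
under eq_Rintegral do rewrite E.
by rewrite Ew; apply: eq_bigr => s _; rewrite mul1r.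
Qed.

Lemma affine_moment n a s k : (0 < n)%N ->
  (P n).-integrable setT (EFin \o (fun w => (s^-1 * (field_sum S X n w - a)) ^+ k)) /\
  \int[P n]_w ((s^-1 * (field_sum S X n w - a)) ^+ k) =
  (\sum_(l < k.+1) 'C(k, l)%:R * ((- a) ^+ (k - l) * sum_moment n l)) / s ^+ k.
Proof.
move=> n0.
have [|iw Ew] := @Rintegral_lincomb _ _ _ (P n) _ (index_enum 'I_k.+1)
   (fun l : 'I_k.+1 => 'C(k, l)%:R * (- a) ^+ (k - l) / s ^+ k)
   (fun l w => field_sum S X n w ^+ l).
  by move=> l _; exact: (field_sum_moment l n0).1.
have E w : (s^-1 * (field_sum S X n w - a)) ^+ k =
    \sum_(l < k.+1) 'C(k, l)%:R * (- a) ^+ (k - l) / s ^+ k * field_sum S X n w ^+ l.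
  rewrite exprMn exprVn [field_sum S X n w - a]addrC exprDn mulr_sumr.
  by apply: eq_bigr => l _; rewrite -[_ *+ 'C(k, l)]mulr_natr; ring.
split; first by apply: eq_integrable iw => //= w _; rewrite E.
under eq_Rintegral do rewrite E.
rewrite Ew mulr_suml; apply: eq_bigr => l _; rewrite (field_sum_moment l n0).2; ring.
Qed.

Lemma field_sum_mean n : (0 < n)%N ->
  fine 'E_(P n)[field_sum S X n]%E = sum_moment n 1.
Proof.
move=> n0; rewrite -(field_sum_moment 1 n0).2 unlock /Rintegral; congr fine.
Qed.

(** Centring annihilates the first cumulant and leaves the second unchanged; the recursion then
    equates the second moment with the second cumulant. *)
Lemma field_sum_variance n : (0 < n)%N ->
  fine 'V_(P n)[field_sum S X n]%E = sum_cumulant n 2.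
Proof.
move=> n0; have [_] := affine_moment (sum_moment n 1) 1 2 n0.
rewrite expr1n divr1.
have := cumulant_rec_shift (sum_moment n 1) (sum_moment_rec n).
set c := (X in cumulant_rec X _) => rec.
have m1 : sum_moment n 1 = sum_cumulant n 1.
  by rewrite sum_moment_rec big_ord_recl big_ord0 /= sum_moment0 bin0 mulr1 mul1r addr0.
have c0 : c 0%N = 1.
  by rewrite /c big_ord_recl big_ord0 bin0 subnn expr0 sum_moment0 !mulr1 addr0.
rewrite -/(c 2) rec !big_ord_recl big_ord0 /= m1 subrr mulr0 mul0r add0r addr0.
rewrite subnn c0 mulr1 bin1 mul1r => <-.
rewrite /variance covariance.unlock field_sum_mean// expectation.unlock m1.
rewrite /Rintegral; congr fine.
by apply: eq_integral => w _; rewrite invr1 mul1r expr2.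
Qed.

End field_sum_moments.

(** * The central limit theorem *)

Lemma standardizeE (R : realType) d (T : measurableType d) (P : probability T R)
    (Y : {mfun T >-> R}) w :
  standardize P Y w = (Num.sqrt (fine 'V_P[Y]%E))^-1 * (Y w - fine 'E_P[Y]%E).
Proof. by []. Qed.

Lemma cvg0_div_growth (R : realType) (u w : nat -> R) (D : R) :
  (forall n, 0 < w n) ->
  (forall A : nat, \forall n \near \oo, A%:R <= w n) ->
  (forall n, `|u n| <= D / w n) -> u n @[n --> \oo] --> 0.
Proof.
move=> w0 wy uD; apply/cvgr0Pnorm_lt => e e0.
have D0 : 0 <= D.
  by have := le_trans (normr_ge0 _) (uD 0%N); rewrite pmulr_lge0// invr_gt0.
apply: filterS (wy (Num.bound (D / e))) => n Aw.
rewrite (le_lt_trans (uD n))// ltr_pdivrMr// mulrC -ltr_pdivrMr//.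
by apply: lt_le_trans Aw; rewrite archi_boundP// divr_ge0// ltW.
Qed.

Theorem theorem1p9 (R : realType) (V : groupType) (S : set V)
    (hS : cayley_data S)
    (d : nat -> measure_display) (T : forall n, measurableType (d n))
    (P : forall n, probability (T n) R)
    (X : forall n, V -> {RV P n >-> R})
    (hmom : bounded_moments S X)
    (C c : nat -> R) (phi : R -> R)
    (hC : forall K : nat, (1 <= K)%N -> 0 < C K /\ 0 < c K)
    (hphi : fast_decreasing phi) (hsum : summable_in S phi)
    (hclust : clustering_mixed_moments S X C c phi)
    (nu : R) (hnu : 0 < nu)
    (hvar : seq_Omega (fun n => fine 'V_(P n)[field_sum S X n])
                     (fun n => (cayley_growth S n)%:R `^ nu)) :
  @cvg_in_law R d T P (fun n => standardize (P n) (field_sum S X n))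
    (normal_prob 0 1).
Proof.
move=> f cf [M fM].
have [v [v0 [n1 _ hn1]]] := hvar.
have [n2 hn2] := cayley_growth_unbounded hS 1.
(* Beyond n0 the index is positive, the variance bound holds and the growth is at least 1, so all
   variances are positive. The shift does not affect the limit. *)
pose n0 := (n1 + n2).+1; pose N n := (n + n0)%N.
have N0 n : (0 < N n)%N by rewrite /N addnS.
pose w n : R := (cayley_growth S (N n))%:R.
have w1 n : 1 <= w n by rewrite ler1n; apply: hn2; rewrite /N /n0; lia.
have w0 n : 0 < w n by exact: lt_le_trans (w1 n).
have wy (A : nat) : \forall n \near \oo, A%:R <= w n.
  have [n3 hn3] := cayley_growth_unbounded hS A; exists n3 => // n /= n3n.
  by rewrite ler_nat; apply: hn3; rewrite (leq_trans n3n)// leq_addr.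
pose H n := field_sum S X (N n).
pose var n := fine 'V_(P (N n))[H n]%E.
have var_ge n : v * w n `^ nu <= var n by apply: hn1; rewrite /= /N /n0; lia.
have var0 n : 0 < var n by apply: lt_le_trans (var_ge n); rewrite mulr_gt0// powR_gt0.
pose sg n := Num.sqrt (var n).
have sg0 n : 0 < sg n by rewrite sqrtr_gt0.
pose mu n := sum_moment S X (N n) 1.
(* Index 0 lies outside the recursion; the value 0 there makes all orders converge to those of the
   normal law. *)
pose tau n j := if j is j'.+1 then
  (if j == 1%N then sum_cumulant S X (N n) 1 - mu n else sum_cumulant S X (N n) j) / sg n ^+ j
  else 0.
pose m n k := \int[P (N n)]_x (((sg n)^-1 * (H n x - mu n)) ^+ k).
have mi n k := (affine_moment hS hmom (mu n) (sg n) k (N0 n)).1.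
have mE n k : m n k = _ := (affine_moment hS hmom (mu n) (sg n) k (N0 n)).2.
have m0 n : m n 0%N = 1.
  by rewrite mE big_ord_recl big_ord0 /= !expr0 sum_moment0 bin0 !mulr1 addr0 divr1.
have mtau n : cumulant_rec (m n) (tau n).
  have := cumulant_rec_scale (lt0r_neq0 (sg0 n))
    (cumulant_rec_shift (mu n) (sum_moment_rec S X (N n))).
  by apply: eq_cumulant_rec => [k|//]; rewrite mE.
have mpsd n : hankel_psd (m n) by apply: moments_hankel_psd; exact: mi.
have tau1 n : tau n 1%N = 0.
  rewrite /tau /= /mu (sum_moment_rec S X (N n) 0) big_ord_recl big_ord0 /=.
  by rewrite sum_moment0 bin0 mulr1 mul1r addr0 subrr mul0r.
have tau2 n : tau n 2%N = 1.
  rewrite /tau /= -field_sum_variance// /sg sqr_sqrtr ?(ltW (var0 n))//.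
  by rewrite -/(H n) -/(var n) divff// lt0r_neq0.
(* For k >= K one has k nu / 2 >= 2, so the k-th power of the standard deviation is at least a
   constant times w^2: one factor w beats the cumulant, the other tends to infinity. The added 2
   excludes the orders 0 and 1. *)
pose K := (Num.bound (4 / nu)).+2.
have tauK k : (K <= k)%N -> tau n k @[n --> \oo] --> 0.
  case: k => [|[|k]]// Kk.
  have [B hB] := sum_kappa_growth hS hmom hC hphi hsum hclust k.+1.
  apply: (@cvg0_div_growth _ _ w (B / Num.sqrt v ^+ k.+2)) => // n.
  rewrite /tau /= normrM normfV [X in _ / X]gtr0_norm ?exprn_gt0//.
  have hBn : `|sum_cumulant S X (N n) k.+2| <= B * w n by exact: hB.
  have B0 : 0 <= B by have := le_trans (normr_ge0 _) hBn; rewrite pmulr_lge0.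
  have sv0 : 0 < Num.sqrt v by rewrite sqrtr_gt0.
  have sgk : Num.sqrt v ^+ k.+2 * w n ^+ 2 <= sg n ^+ k.+2.
    apply: (@le_trans _ _ ((Num.sqrt v * w n `^ (nu / 2)) ^+ k.+2)).
      rewrite exprMn ler_wpM2l ?exprn_ge0 ?(ltW sv0)//.
      rewrite -!powR_mulrn ?powR_ge0 ?(ltW (w0 n))// -powRrM ler_powR//.
      rewrite -ler_pdivrMl ?divr_gt0//.
      have -> : (nu / 2)^-1 * 2%:R = 4 / nu by field; rewrite lt0r_neq0.
      have /archi_boundP/ltW/le_trans : 0 <= 4 / nu by rewrite divr_ge0// ltW.
      by apply; rewrite ler_nat; move: Kk; rewrite /K; lia.
    rewrite lerXn2r ?nnegrE ?mulr_ge0 ?powR_ge0 ?(ltW sv0) ?(ltW (sg0 n))//.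
    rewrite -(@ler_sqr _ _ (sg n)) ?nnegrE ?mulr_ge0 ?powR_ge0 ?(ltW sv0) ?(ltW (sg0 n))//.
    rewrite exprMn !sqr_sqrtr ?(ltW v0) ?(ltW (var0 n))//.
    by rewrite -powR_mulrn ?powR_ge0// -powRrM divfK.
  rewrite ler_pdivrMr ?exprn_gt0//.
  apply: (@le_trans _ _ (B / Num.sqrt v ^+ k.+2 / w n * (Num.sqrt v ^+ k.+2 * w n ^+ 2))).
    apply: le_trans hBn _; rewrite le_eqVlt; apply/orP; left; apply/eqP.
    by field; rewrite expf_neq0 ?lt0r_neq0//; apply: w0.
  by rewrite ler_wpM2l// !divr_ge0 ?exprn_ge0// ltW.
have tau_cvg j : tau n j @[n --> \oo] --> ((j == 2%N)%:R : R).
  case: j => [|[|[|j]]]; [exact: cvg_cst| | |].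
  - by apply: cvg_near_cst; apply: nearW.
  - by apply: cvg_near_cst; apply: nearW.
  - exact: janson m0 mtau mpsd tau1 tau2 tauK _ _.
have [|m' [m'0 m'rec mcvg]] := @cumulant_rec_cvg R nat \oo m tau (fun j => (j == 2%N)%:R) _ _ tau_cvg.
  by apply: nearW.
(* The limits of the moments have the Gaussian cumulants, hence are the Gaussian moments. *)
have m'E := cumulant_rec_uniq (etrans m'0 (esym (gauss_moment0 R))) m'rec (gauss_cumulant_rec R).
have YE n x : standardize (P (N n)) (H n) x = (sg n)^-1 * (H n x - mu n).
  by rewrite standardizeE (field_sum_mean hS hmom (N0 n)).
pose Y n x := standardize (P (N n)) (H n) x.
have mY n : measurable_fun setT (Y n) by exact: measurable_funPT.
have Yi n k : (P (N n)).-integrable setT (EFin \o (fun x => Y n x ^+ k)).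
  by apply: eq_integrable (mi n k) => //= x _; rewrite /Y YE.
have EE n : 'E_(P (N n))[f \o standardize (P (N n)) (H n)]%E = (\int[P (N n)]_x f (Y n x))%:E.
  rewrite expectation.unlock /Rintegral fineK//.
  exact: integrable_fin_num (bounded_continuous_integrable _ _ cf fM).
rewrite -(cvg_shiftn n0) (_ : (fun n => _) = (fun n => (\int[P (N n)]_x f (Y n x))%:E)); last first.
  by apply/funext => n; exact: EE.
pose Q := normal_prob 0 1 : probability (measurableTypeR R) R.
have mZ : measurable_fun setT (id : measurableTypeR R -> R) by exact: measurable_id.
have <- : (\int[Q]_x f x)%:E = (\int[normal_prob 0 1]_x (f x)%:E)%E.
  rewrite /Rintegral fineK//.
  exact: integrable_fin_num (bounded_continuous_integrable _ mZ cf fM).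
apply: cvg_EFin; first exact: nearW.
apply: (method_of_moments mY mZ Yi (@gauss_moment_integrable R) _ (@gauss_moment_growth R) cf fM).
move=> k; have /= <- := m'E k; have := mcvg k.
rewrite (_ : (fun n => m n k) = (fun n => \int[P (N n)]_x (Y n x ^+ k)))//.
by apply/funext => n; apply: eq_Rintegral => x _; rewrite /Y YE.
Qed.
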